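(* For $\mu\in\Delta^+_l$ and $I\in\mathfrak{Ab}$, we have $I\in\mathfrak{Ab}_\mu$ if and only if $I\cap\mathcal H=I(\mu)_{\min}$.
   Context: Let $\mathfrak g$ be a complex simple Lie algebra with triangular decomposition $\mathfrak g=\mathfrak u\oplus\mathfrak t\oplus\mathfrak u^-$, Borel subalgebra $\mathfrak b=\mathfrak u\oplus\mathfrak t$, root system $\Delta$ of $(\mathfrak g,\mathfrak t)$, positive roots $\Delta^+$ (corresponding to $\mathfrak u$), simple roots $\Pi=\{\alpha_1,\dots,\alpha_n\}$, highest root $\theta$, Weyl group $W$, and $W$-invariant inner product $(\ ,\ )$ on $V=\bigoplus_i\mathbb R\alpha_i$. $\Delta^+_l$ is the set of long positive roots (all roots are long in the simply-laced case), and $\mathcal H=\{\gamma\in\Delta^+\mid(\gamma,\theta)\ne0\}$. Root order on $\Delta^+$: $\mu\preccurlyeq\nu$ iff $\nu-\mu$ is a non-negative integral combination of simple roots. Abelian ideals: $\mathfrak{Ab}$ is the poset (under inclusion) of subspaces $\mathfrak a\subset\mathfrak u$ with $[\mathfrak b,\mathfrak a]\subset\mathfrak a$ and $[\mathfrak a,\mathfrak a]=0$. Each is a sum of root spaces and is identified with the corresponding set $I\subset\Delta^+$, which is an upper ideal of $(\Delta^+,\preccurlyeq)$ with no two elements summing to a root. Minuscule elements: let $\widehat V=V\oplus\mathbb R\delta\oplus\mathbb R\lambda$ with $(\delta,V)=(\lambda,V)=(\delta,\delta)=(\lambda,\lambda)=0$, $(\delta,\lambda)=1$; $\alpha_0=\delta-\theta$;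 $\mu^\vee=2\mu/(\mu,\mu)$; $s_i(x)=x-(x,\alpha_i)\alpha_i^\vee$ for $0\le i\le n$; $\widehat W=\langle s_0,\dots,s_n\rangle\subset GL(\widehat V)$; $\widehat\Delta^+=\Delta^+\cup\{\gamma+k\delta\mid\gamma\in\Delta,\ k\ge1\}$; $\mathcal N(w)=\{\nu\in\widehat\Delta^+\mid w(\nu)\in-\widehat\Delta^+\}$. An element $w\in\widehat W$ is minuscule if $\mathcal N(w)=\{\delta-\gamma\mid\gamma\in I_w\}$ for some $I_w\subset\Delta$. Then $I_w$ is an abelian ideal and $w\mapsto I_w$ is a bijection from minuscule elements onto $\mathfrak{Ab}$; write $w_I$ for the element corresponding to $I$. Rootlets: for a nonzero abelian ideal $I$, the rootlet is $\mathrm{rt}(I)=w_I(2\delta-\theta)$, which lies in $\Delta^+_l$. For $\mu\in\Delta^+_l$, $\mathfrak{Ab}_\mu$ is the set of nonzero abelian ideals with rootlet $\mu$. It is known that $\mathfrak{Ab}_\mu$ is nonempty and has a unique minimal element $I(\mu)_{\min}$ and a unique maximal element $I(\mu)_{\max}$. *)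

(* Defs.v *)
From mathcomp Require Import all_boot all_order all_algebra.
From mathcomp Require Import all_classical reals.
From mathcomp.real_closed Require Export complex.

Set Implicit Arguments.
Unset Strict Implicit.
Unset Printing Implicit Defensive.

Import Order.TTheory GRing.Theory Num.Theory.

Local Open Scope classical_set_scope.
Local Open Scope ring_scope.

(** * Complex Lie algebras *)

Definition lie_bracket (R : realType) (g : vectType R[i])
    (br : {bilinear g -> g -> g}) : Prop :=
  (forall x, br x x = 0) /\
  (forall x y z, br x (br y z) + br y (br z x) + br z (br x y) = 0).

Definition simple_lie (R : realType) (g : vectType R[i])
    (br : {bilinear g -> g -> g}) : Prop :=
  [/\ lie_bracket br,
      exists x y, br x y != 0 &
      forall J : {vspace g}, (forall x y, y \in J -> br x y \in J) ->
        J = 0%VS \/ J = fullv].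

(* The linear span of an arbitrary set of vectors. *)
Definition lin_span (R : realType) (g : vectType R[i]) (A : set g) : set g :=
  [set x | forall U : {vspace g}, (forall y, A y -> y \in U) -> x \in U].

(** * Roots of (g, t) *)

(* The dual t^* of the subspace t. *)
Notation dual t := ('Hom(subvs_of t, (_ [i])^o)).

Section Roots.
Context (R : realType) (g : vectType R[i]) (br : {bilinear g -> g -> g}).
Context (t : {vspace g}).

Definition root_space (l : dual t) : set g :=
  [set x | forall h : subvs_of t, br (vsval h) x = l h *: x].

Definition root_functional (l : dual t) : Prop :=
  l != 0 /\ exists2 x, x != 0 & root_space l x.

Definition is_coroot (l : dual t) (h : subvs_of t) : Prop :=
  l h = 2 /\ exists e f, [/\ root_space l e, root_space (- l) f & br e f = vsval h].

Definition root_base n (alpha : 'I_n -> dual t) : Prop :=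
  [/\ free [seq alpha i | i : 'I_n],
      forall i, root_functional (alpha i) &
      forall l, root_functional l -> exists c : 'I_n -> nat,
        l = \sum_i (c i)%:R *: alpha i \/ l = - \sum_i (c i)%:R *: alpha i].

End Roots.

(** * The real space V spanned by the simple roots

   V is modelled by 'rV[R]_n: a vector is the row of its coordinates in the
   basis alpha of simple roots, and [toV] sends it to the functional on t. *)

Section RealForm.
Context (R : realType) (g : vectType R[i]) (br : {bilinear g -> g -> g}).
Context (t : {vspace g}) (n : nat) (alpha : 'I_n -> dual t).

Local Notation V := 'rV[R]_n.

Definition toV (x : V) : dual t := \sum_i (x 0 i)%:C%C *: alpha i.

Definition simple_root (i : 'I_n) : V := delta_mx 0 i.

(* The root order: y - x is a sum of simple roots. *)
Definition root_le (x y : V) : Prop := forall i, (y - x) 0 i \is a Num.nat.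

Definition Delta : set V := [set x | root_functional br (toV x)].

Definition Deltap : set V := [set x | Delta x /\ root_le 0 x].

Definition highest_root (theta : V) : Prop :=
  Deltap theta /\ forall x, Deltap x -> root_le x theta.

(** ** Triangular decomposition and abelian ideals *)

Definition u_plus : set g :=
  lin_span (\bigcup_(x in Deltap) root_space br (toV x)).

Definition u_minus : set g :=
  lin_span (\bigcup_(x in Deltap) root_space br (- toV x)).

Definition borel : set g :=
  [set z | exists x h, [/\ u_plus x, h \in t & z = x + h]].

(* t is a Cartan subalgebra (a self-centralising, ad-diagonalisable one; the
   diagonalisability is part of g = u (+) t (+) u^-), alpha is a basis of its
   root system. *)
Definition triangular_decomposition : Prop :=
  [/\ forall x, x \in t <-> (forall h, h \in t -> br h x = 0),
      root_base br alpha &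
      forall z, exists! p : g * g * g,
        [/\ u_plus p.1.1, p.1.2 \in t, u_minus p.2 & z = p.1.1 + p.1.2 + p.2]].

Definition abelian_ideal (a : {vspace g}) : Prop :=
  [/\ forall x, x \in a -> u_plus x,
      forall b x, borel b -> x \in a -> br b x \in a &
      forall x y, x \in a -> y \in a -> br x y = 0].

(* The set of positive roots with which an abelian ideal is identified. *)
Definition ideal_roots (a : {vspace g}) : set V :=
  [set x | Deltap x /\ forall y, root_space br (toV x) y -> y \in a].

(** ** Weyl-invariant inner products *)

Context (ip : {dot V for @idfun R}).

(* Invariance under the generators s_x of W, s_x(y) = y - y(h_x) x, where h_x
   is the coroot of the root x; y' stands for s_x(y) and z' for s_x(z). *)
Definition weyl_invariant : Prop :=
  forall x h, Delta x -> is_coroot br (toV x) h ->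
  forall y y' z z' : V,
    toV y' = toV y - toV y h *: toV x ->
    toV z' = toV z - toV z h *: toV x ->
    ip y' z' = ip y z.

Definition Deltap_long : set V :=
  [set x | Deltap x /\ forall y, Delta y -> ip y y <= ip x x].

(** ** The affine Weyl group and minuscule elements

   (x, a, b) : hatV is x + a delta + b lambda. *)

Local Notation hatV := (V * R^o * R^o)%type.

Definition hat (x : V) : hatV := (x, 0, 0).
Definition hat_delta : hatV := (0, 1, 0).

Definition hatform (u v : hatV) : R :=
  ip u.1.1 v.1.1 + u.1.2 * v.2 + u.2 * v.1.2.

Context (theta : V).

(* [None] is the index 0, [Some i] the index of a simple root of Delta. *)
Definition hat_simple (i : option 'I_n) : hatV :=
  if i is Some j then hat (simple_root j) else hat_delta - hat theta.

Definition hat_co (u : hatV) : hatV := (2 / hatform u u) *: u.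

Definition hat_refl (i : option 'I_n) (u : hatV) : hatV :=
  u - hatform u (hat_simple i) *: hat_co (hat_simple i).

(* The s_i are involutions, so the group they generate is the set of words. *)
Definition hatW : set (hatV -> hatV) :=
  [set w | exists s : seq (option 'I_n),
     w = foldr (fun i f => hat_refl i \o f) id s].

Definition hatDeltap : set hatV :=
  [set u | (exists2 x, Deltap x & u = hat x) \/
           (exists x k, [/\ Delta x, (1 <= k)%N & u = hat x + k%:R *: hat_delta])].

Definition inversions (w : hatV -> hatV) : set hatV :=
  [set u | hatDeltap u /\ hatDeltap (- w u)].

(* w is minuscule, with I_w = I. *)
Definition minuscule_for (w : hatV -> hatV) (I : set V) : Prop :=
  [/\ hatW w, I `<=` Delta & inversions w = [set hat_delta - hat x | x in I]].

(* w_I: an abelian ideal I has exactly one minuscule element. *)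
Definition minuscule_elt (I : set V) : hatV -> hatV :=
  @xget (hatV -> hatV : choiceType) id [set w | minuscule_for w I].

(** ** Rootlets *)

Definition rootlet (a : {vspace g}) : hatV :=
  minuscule_elt (ideal_roots a) (2 *: hat_delta - hat theta).

Definition Ab (mu : V) : set {vspace g} :=
  [set a | [/\ abelian_ideal a, a != 0%VS & rootlet a = hat mu]].

(* I(mu)_min: for a long positive root mu, Ab mu has exactly one minimal
   element. *)
Definition Ab_min (mu : V) : {vspace g} :=
  xget 0%VS [set a | Ab mu a /\ forall b, Ab mu b -> (b <= a)%VS -> b = a].

Definition Hset : set V := [set x | Deltap x /\ ip x theta != 0].

End RealForm.

(* Main.v *)
Require Import Defs.
From mathcomp Require Import all_boot all_order all_algebra.
From mathcomp Require Import all_classical reals.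
From mathcomp Require Import lra ring zify.

(** The theorem says that two nonzero abelian ideals have the same rootlet if and
only if they have the same intersection with H, the set of positive roots not
orthogonal to [theta], and that every long positive root is a rootlet. Indeed the
intersection of an ideal with H is again an ideal, so a minimal ideal with a given
rootlet is contained in H ([Ab_iff_cap_H]).

Adding to an ideal a root g that is not a sum of a root of the ideal and a positive
root multiplies its minuscule element w on the left by a simple reflection s_i, where
alpha_i = w(delta - g) ([minuscule_next]); hence every ideal has a minuscule element.
The inner product of alpha_i with the rootlet w(2 delta - theta) is that of delta - g
with 2 delta - theta, which is (g, theta). If g is not in H this is zero, and the
rootlet does not change ([ideal_minuscule]). If g is in H this is positive, which
excludes the affine simple root; so an ideal inside H has a minuscule element v s_0
with v in the finite Weyl group, and its rootlet is v(theta) ([finite_minuscule]).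

Conversely, if mu = v(theta) is long and different from [theta], it makes an obtuse
angle with some simple root alpha_i, and s_i v s_0 is the minuscule element of an
ideal with one root less and rootlet s_i(mu), which is higher than mu. Climbing in
this way to [theta], the rootlet of the single ideal {theta} inside H, shows that mu
determines the ideal ([rootlet_inj]), and going down the same way shows that every
long positive root occurs ([rootlet_surj]). A minuscule element is determined by its
inversions because of the exchange condition ([wact_inj_pos]).

This combinatorial argument needs that the roots of the Lie algebra form a reduced
root system for the given inner product ([Delta_root_system]) and that abelian ideals
correspond to the sets of positive roots closed under adding positive roots and
containing no two roots whose sum is a root ([ideal_roots_ideal], [ideal_of_roots]).
Both rest on sl2-triples, which come from the nondegeneracy of the Killing form. Here
nondegeneracy follows from simplicity alone: the radical is an ideal, and it is not
the whole algebra since an element of [t] on which all simple roots are 1 acts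
diagonalizably with integral eigenvalues, not all zero
([killing_nondegenerate]). *)

Set Implicit Arguments.
Unset Strict Implicit.
Unset Printing Implicit Defensive.

Import Order.TTheory GRing.Theory Num.Theory.

Local Open Scope classical_set_scope.
Local Open Scope ring_scope.

(** * Inner products on row vectors *)

Section DotProduct.
Context (R : realType) (n : nat) (ip : {dot 'rV[R]_n for @idfun R}).
Implicit Types x y z : 'rV[R]_n.

Lemma ipC x y : ip x y = ip y x.
Proof. by rewrite hermC /= expr0 mul1r. Qed.

Lemma ipDl x y z : ip (x + y) z = ip x z + ip y z.
Proof. by rewrite linearDl. Qed.

Lemma ipZl a x z : ip (a *: x) z = a * ip x z.
Proof. by rewrite linearZl. Qed.

Lemma ipNl x z : ip (- x) z = - ip x z.
Proof. by rewrite -scaleN1r ipZl mulN1r. Qed.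

Lemma ipBl x y z : ip (x - y) z = ip x z - ip y z.
Proof. by rewrite ipDl ipNl. Qed.

Lemma ip0l z : ip 0 z = 0.
Proof. by rewrite -[0](scale0r z) ipZl mul0r. Qed.

Lemma ipDr x y z : ip z (x + y) = ip z x + ip z y.
Proof. by rewrite !(ipC z) ipDl. Qed.

Lemma ipZr a x z : ip z (a *: x) = a * ip z x.
Proof. by rewrite !(ipC z) ipZl. Qed.

Lemma ipNr x z : ip z (- x) = - ip z x.
Proof. by rewrite !(ipC z) ipNl. Qed.

Lemma ipBr x y z : ip z (x - y) = ip z x - ip z y.
Proof. by rewrite ipDr ipNr. Qed.

Lemma ip0r z : ip z 0 = 0.
Proof. by rewrite ipC ip0l. Qed.

Lemma ip_suml (I : finType) (F : I -> 'rV[R]_n) z :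
  ip (\sum_i F i) z = \sum_i ip (F i) z.
Proof.
by elim/big_rec2: _ => [|i a b _ <-]; rewrite ?ip0l ?ipDl.
Qed.

Lemma ip_gt0 x : x != 0 -> 0 < ip x x.
Proof. exact: neq0_dnorm_gt0. Qed.

Lemma ip_ge0 x : 0 <= ip x x.
Proof. by have [->|/ip_gt0/ltW//] := eqVneq x 0; rewrite ip0l. Qed.

Definition ipE := (ipBl, ipBr, ipDl, ipDr, ipNl, ipNr, ipZl, ipZr, ip0l, ip0r).

Definition cartan y x := 2 * ip y x / ip x x.

End DotProduct.

(** * Based root systems *)

Record root_system (R : realType) (n : nat) (D : set 'rV[R]_n)
    (ip : {dot 'rV[R]_n for @idfun R}) : Prop := RootSystem {
  rs_simple : forall i, D (simple_root R i);
  rs_neq0 : forall x, D x -> x != 0;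
  rs_opp : forall x, D x -> D (- x);
  rs_sign : forall x, D x -> root_le 0 x \/ root_le 0 (- x);
  rs_int : forall x y, D x -> D y -> cartan ip y x \is a Num.int;
  rs_refl : forall x y, D x -> D y -> D (y - cartan ip y x *: x);
  rs_reduced : forall i (m : nat), D (m%:R *: simple_root R i) -> m = 1%N }.

Lemma root_le0P (R : realType) (n : nat) (x : 'rV[R]_n) :
  root_le 0 x <-> forall i, x 0 i \is a Num.nat.
Proof. by split=> h i; have := h i; rewrite subr0. Qed.

Lemma int_ge1 (R : realType) (z : R) : z \is a Num.int -> 0 < z -> 1 <= z.
Proof.
by move=> /intrP[m ->]; rewrite ltr0z => m0; rewrite (ler_int R 1 m); lia.
Qed.

Section FiniteRoots.
Context (R : realType) (n : nat) (D : set 'rV[R]_n).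
Context (ip : {dot 'rV[R]_n for @idfun R}) (theta : 'rV[R]_n).
Local Notation V := 'rV[R]_n.
Local Notation e := (@simple_root R n).

Definition pos_root : set V := [set x | D x /\ root_le 0 x].
Local Notation P := pos_root.

Context (rsD : root_system D ip).
Context (pos_theta : P theta) (theta_max : forall x, P x -> root_le x theta).

Implicit Types x y z : V.

Definition height x := \sum_i x 0 i.

Lemma heightD x y : height (x + y) = height x + height y.
Proof. by rewrite -big_split; apply: eq_bigr => i _; rewrite mxE. Qed.

Lemma heightZ a x : height (a *: x) = a * height x.
Proof. by rewrite mulr_sumr; apply: eq_bigr => i _; rewrite mxE. Qed.

Lemma heightN x : height (- x) = - height x.
Proof. by rewrite -scaleN1r heightZ mulN1r. Qed.

Lemma heightB x y : height (x - y) = height x - height y.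
Proof. by rewrite heightD heightN. Qed.

Lemma height0 : height 0 = 0.
Proof. by rewrite -(scale0r 0) heightZ mul0r. Qed.

Lemma height_simple i : height (e i) = 1.
Proof.
rewrite /height (bigD1 i)//= mxE !eqxx big1 ?addr0// => j ji.
by rewrite mxE eqxx (negPf ji).
Qed.

Lemma height_nat x : root_le 0 x -> height x \is a Num.nat.
Proof. by move/root_le0P=> h; apply: rpred_sum => i _. Qed.

Lemma coord_ge0 x i : root_le 0 x -> 0 <= x 0 i.
Proof. by move/root_le0P/(_ i)/natr_ge0. Qed.

Lemma simple_sum x : x = \sum_i x 0 i *: e i.
Proof. exact: row_sum_delta. Qed.

Lemma nonneg_neq0 x : (forall i, 0 <= x 0 i) -> x != 0 -> 0 < height x.
Proof.
move=> h x0; rewrite lt_neqAle sumr_ge0 // andbT eq_sym.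
apply: contra x0 => /eqP hx; apply/eqP/rowP => i; rewrite mxE.
by have /psumr_eq0P/(_ hx) -> := fun i (_ : true) => h i.
Qed.

Lemma height_gt0 x : P x -> 0 < height x.
Proof.
by case=> Dx px; apply: nonneg_neq0 (rs_neq0 rsD Dx) => i; exact: coord_ge0.
Qed.

Lemma pos_or_neg x : D x -> P x \/ P (- x).
Proof.
move=> Dx; have [h|h] := rs_sign rsD Dx; [left|right]; split=> //.
exact: rs_opp rsD _ Dx.
Qed.

Lemma pos_height x : D x -> 0 < height x -> P x.
Proof.
move=> /pos_or_neg[//|/height_gt0]; rewrite heightN => h1 h2; lra.
Qed.

Lemma pos_simple i : P (e i).
Proof.
by apply: pos_height; rewrite ?height_simple//; exact: rs_simple rsD _.
Qed.

Lemma root_coord_int x i : D x -> x 0 i \is a Num.int.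
Proof.
case/pos_or_neg=> -[_ /root_le0P/(_ i)/intr_nat//].
by rewrite mxE rpredN.
Qed.

Lemma height_int x : D x -> height x \is a Num.int.
Proof. by move=> Dx; apply: rpred_sum => i _; exact: root_coord_int. Qed.

Lemma pos_rootD x y : P x -> P y -> D (x + y) -> P (x + y).
Proof.
move=> px py Dxy; apply: pos_height => //.
by rewrite heightD addr_gt0// height_gt0.
Qed.

(** If both Cartan integers of two roots at an obtuse angle were at most -2,
the norm of the sum of the roots would be at most 0. *)
Lemma root_add x y : D x -> D y -> ip x y < 0 -> x + y != 0 -> D (x + y).
Proof.
move=> Dx Dy xy0 xyn0.
have xx := ip_gt0 ip (rs_neq0 rsD Dx); have yy := ip_gt0 ip (rs_neq0 rsD Dy).
have intle1 (z : R) : z \is a Num.int -> z < 0 -> z != -1 -> z <= -2.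
  move=> /intrP[m ->]; rewrite ltrz0 => m0.
  rewrite -[-1]/((-1)%:~R) eqr_int -[-2]/((-2)%:~R) ler_int; lia.
have [/eqP a1|a1] := boolP (cartan ip x y == -1).
  by have := rs_refl rsD Dy Dx; rewrite a1 scaleN1r opprK.
have [/eqP b1|b1] := boolP (cartan ip y x == -1).
  by have := rs_refl rsD Dx Dy; rewrite b1 scaleN1r opprK addrC.
have := intle1 _ (rs_int rsD Dy Dx) _ a1.
have := intle1 _ (rs_int rsD Dx Dy) _ b1.
rewrite /cartan (ipC ip y x) !ltr_pdivrMr// !ler_pdivrMr//.
move=> /(_ ltac:(lra)) h1 /(_ ltac:(lra)) h2.
have := ip_gt0 ip xyn0; rewrite !ipE (ipC ip y x); lra.
Qed.

Lemma root_sub x y : D x -> D y -> 0 < ip x y -> x != y -> D (x - y).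
Proof.
move=> Dx Dy xy0 xy; apply: root_add => //; last by rewrite subr_eq0.
  exact: rs_opp rsD _ Dy.
by rewrite ipE oppr_lt0.
Qed.

Lemma ip_nonneg z x : (forall i, 0 <= x 0 i) ->
  (forall i, 0 <= ip z (e i)) -> 0 <= ip z x.
Proof.
move=> x0 h; rewrite [x]simple_sum ipC ip_suml sumr_ge0// => i _.
by rewrite ipE ipC mulr_ge0.
Qed.

Lemma theta_coord x i : D x -> - theta 0 i <= x 0 i <= theta 0 i.
Proof.
have key y : P y -> 0 <= y 0 i <= theta 0 i.
  move=> py; rewrite (coord_ge0 _ py.2)/=.
  by have /natr_ge0 := theta_max py i; rewrite !mxE subr_ge0.
move=> Dx; have kt := key _ pos_theta.
have [/key|/key] := pos_or_neg Dx; first by lra.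
by rewrite mxE; lra.
Qed.

Lemma theta_height x : P x -> height x <= height theta.
Proof.
by case=> Dx _; apply: ler_sum => i _; case/andP: (theta_coord i Dx).
Qed.

Lemma theta_eq x : P x -> height theta <= height x -> x = theta.
Proof.
move=> px h; apply/eqP; rewrite eq_sym -subr_eq0; apply: contraT.
move=> /nonneg_neq0; rewrite heightB subr_gt0 => /(_ _)/wrap[].
  by move=> i; rewrite !mxE subr_ge0; case/andP: (theta_coord i px.1).
by rewrite ltNge h.
Qed.

Lemma theta_dominant i : 0 <= ip theta (e i).
Proof.
rewrite leNgt; apply/negP => h.
have n0 : theta + e i != 0.
  apply/eqP => /(congr1 height); rewrite heightD height0 height_simple.
  by have := height_gt0 pos_theta; lra.
have Dt := root_add pos_theta.1 (pos_simple i).1 h n0.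
have := theta_height (pos_rootD pos_theta (pos_simple i) Dt).
by rewrite heightD height_simple; lra.
Qed.

Lemma ip_theta_ge0 x : P x -> 0 <= ip x theta.
Proof.
move=> [Dx px]; rewrite ipC; apply: ip_nonneg theta_dominant => i.
exact: coord_ge0.
Qed.

Lemma simple_le_theta i : 0 < theta 0 i.
Proof.
have := theta_max (pos_simple i) i; rewrite !mxE !eqxx/= => /natr_ge0; lra.
Qed.

Lemma ip_theta_gt0 : 0 < ip theta theta.
Proof. exact: ip_gt0 (rs_neq0 rsD pos_theta.1). Qed.

(** All coefficients of [theta] are positive, so a dominant root orthogonal to
[theta] would be orthogonal to every simple root. *)
Lemma not_dominant x : P x -> ip x theta = 0 -> exists i, ip x (e i) < 0.
Proof.
move=> px x0; apply: contrapT => /forallNP h.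
have h' i : 0 <= ip x (e i) by rewrite leNgt; apply/negP/h.
have xe i : ip x (e i) = 0.
  have s0 : \sum_i theta 0 i * ip x (e i) = 0.
    rewrite -[RHS]x0 [in RHS](simple_sum theta) ipC ip_suml.
    by apply: eq_bigr => j _; rewrite ipE ipC.
  have /psumr_eq0P/(_ s0 i isT)/eqP :
      forall j, true -> 0 <= theta 0 j * ip x (e j).
    by move=> j _; rewrite mulr_ge0// ltW// simple_le_theta.
  by rewrite mulf_eq0 gt_eqF ?simple_le_theta//= => /eqP.
have := ip_gt0 ip (rs_neq0 rsD px.1).
rewrite {2}(simple_sum x) ipC ip_suml big1 ?ltxx// => i _.
by rewrite ipE ipC xe mulr0.
Qed.

Definition long x := forall y, D y -> ip y y <= ip x x.

Lemma refl_long x y : D x -> long y -> long (y - cartan ip y x *: x).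
Proof.
move=> Dx ly z /ly h; apply: le_trans h _.
have xx := ip_gt0 ip (rs_neq0 rsD Dx).
rewrite !ipE /cartan (ipC ip x y); set a := ip y x.
rewrite le_eqVlt; apply/orP; left; apply/eqP.
by field; rewrite gt_eqF.
Qed.

(** A dominant long root has at least its own norm as inner product with
[theta], which by Cauchy-Schwarz forces it to be [theta]. *)
Lemma long_not_dominant x : P x -> long x -> x != theta ->
  exists i, ip x (e i) < 0.
Proof.
move=> px lx xt; apply: contrapT => /forallNP h.
have h' i : 0 <= ip x (e i) by rewrite leNgt; apply/negP/h.
have := @ip_nonneg x (theta - x) _ h'; rewrite ipE subr_ge0 => /(_ _)/wrap[].
  by move=> i; rewrite !mxE subr_ge0; case/andP: (theta_coord i px.1).
have := lx _ pos_theta.1; rewrite -subr_eq0 in xt.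
by have := ip_gt0 ip xt; rewrite !ipE (ipC ip theta x); lra.
Qed.

(** A reflection in a simple root changes one coordinate only, so a positive root
becomes negative only if it is a multiple of that simple root. *)
Lemma refl_pos x i : P x -> x != e i -> P (x - cartan ip x (e i) *: e i).
Proof.
move=> px xi; have De := (pos_simple i).1.
have Dr := rs_refl rsD De px.1.
have [//|ng] := pos_or_neg Dr; exfalso.
have x0 j : j != i -> x 0 j = 0.
  move=> ji; apply/le_anti; rewrite (coord_ge0 _ px.2) andbT.
  have := coord_ge0 j ng.2.
  by rewrite !mxE eqxx (negPf ji) mulr0 subr0 oppr_ge0.
have xe : x = x 0 i *: e i.
  apply/rowP => j; rewrite !mxE eqxx/=.
  by have [->|ji] := eqVneq j i; rewrite ?mulr1// mulr0 x0.
have /natrP[m xm] := proj1 (root_le0P x) px.2 i.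
move: xe; rewrite xm => xe.
have := px.1; rewrite xe => /(rs_reduced rsD) m1.
by move: xi; rewrite xe m1 scale1r eqxx.
Qed.

Lemma refl_height x i :
  height (x - cartan ip x (e i) *: e i) = height x - cartan ip x (e i).
Proof. by rewrite heightB heightZ height_simple mulr1. Qed.

Lemma height_lt x y : D x -> D y -> height x < height y ->
  height x + 1 <= height y.
Proof.
move=> /height_int/intrP[a ->] /height_int/intrP[b ->].
by rewrite ltr_int -[1]/(1%:~R) -intrD ler_int; lia.
Qed.

Definition depth x := Num.truncn (height theta - height x).

Lemma depth_lt x y : P x -> P y -> height x < height y ->
  (depth y < depth x)%N.
Proof.
move=> px py xy; rewrite /depth.
have := height_lt px.1 py.1 xy => h.
have hx := theta_height px; have hy := theta_height py.
rewrite truncn_gt_nat -natr1 truncnK; first by lra.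
rewrite natrEint subr_ge0 hy andbT rpredB//; apply: height_int => //.
  exact: pos_theta.1. exact: py.1.
Qed.

(** Reflecting a long root in a simple root at an obtuse angle raises its
height; by [long_not_dominant] this can only stop at [theta]. *)
Lemma long_ind (Q : V -> Prop) : Q theta ->
  (forall x i, P x -> long x -> ip x (e i) < 0 ->
     Q (x - cartan ip x (e i) *: e i) -> Q x) ->
  forall x, P x -> long x -> Q x.
Proof.
move=> Qt step x; move: {2}(depth x).+1 (ltnSn (depth x)) => m.
elim: m x => // m IH x dx px lx.
have [->//|xt] := eqVneq x theta.
have [i xi] := long_not_dominant px lx xt.
have De := (pos_simple i).1.
have xne : x != e i.
  by apply: contraTneq xi => ->; rewrite -leNgt ip_ge0.
have pr := refl_pos px xne.
apply: (step x i) => //; apply: IH => //; last exact: refl_long.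
apply: leq_trans (depth_lt px pr _) dx.
rewrite refl_height ltrDl oppr_gt0 /cartan ltr_pdivrMr ?mul0r; first by lra.
exact: ip_gt0 (rs_neq0 rsD De).
Qed.

(** Reflections preserve length, and the climb from a long root ends in [theta]. *)
Lemma theta_long mu : P mu -> long mu -> long theta.
Proof.
move=> pm lm; apply: contrapT => nt.
apply: (@long_ind (fun x => ~ long x) nt _ mu pm lm lm) => x i px lx _ /= + _; apply.
exact: refl_long (pos_simple i).1 lx.
Qed.

Definition ideal_set (I : set V) := [/\ I `<=` P,
  forall x y, I x -> P y -> D (x + y) -> I (x + y) &
  forall x y, I x -> I y -> ~ D (x + y)].

Definition Hroots : set V := [set x | P x /\ ip x theta != 0].
Local Notation H := Hroots.

Lemma Hroots_gt0 x : H x -> 0 < ip x theta.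
Proof. by case=> px h; rewrite lt_neqAle eq_sym h ip_theta_ge0. Qed.

Lemma Hroots_theta : H theta.
Proof. by split=> //; rewrite gt_eqF ?ip_theta_gt0. Qed.

Lemma Hroots_sub x : H x -> x != theta -> P (theta - x).
Proof.
move=> hx xt; have x0 := Hroots_gt0 hx; case: hx => px _.
have Ds : D (theta - x).
  by apply: root_sub; rewrite 1?ipC 1?eq_sym//; [exact: pos_theta.1|exact: px.1].
apply: pos_height => //; rewrite heightB subr_gt0 ltNge.
by apply: contra xt => /(theta_eq px)/eqP.
Qed.

(** The Cartan integer of [x] with respect to the long root [theta] lies strictly
between 0 and 2. *)
Lemma Hroots_cartan x : long theta -> H x -> x != theta ->
  ip x theta = ip theta theta / 2.
Proof.
move=> lt hx xt; have x0 := Hroots_gt0 hx; case: hx => px _.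
have := rs_int rsD pos_theta.1 px.1; have t0 := ip_theta_gt0.
have c0 : 0 < cartan ip x theta by rewrite divr_gt0// mulr_gt0.
have c2 : cartan ip x theta < 2.
  rewrite ltr_pdivrMr// ltr_pM2l//.
  have := lt _ px.1; rewrite -subr_eq0 in xt.
  by have := ip_gt0 ip xt; rewrite !ipE (ipC ip theta x); lra.
move=> /intrP[m cm]; move: c0 c2; rewrite cm ltr0z -[2]/(2%:~R) ltr_int.
move=> m0 m2; have m1 : m = 1 by lia.
move: cm; rewrite m1 /cartan mulr1z => /(canRL (divfK (lt0r_neq0 t0))).
by rewrite mul1r; lra.
Qed.

Lemma ideal_cap_Hroots I : ideal_set I -> ideal_set (I `&` H).
Proof.
case=> IP Iup Iab; split=> [x []|x y [Ix Hx] Py Dxy|x y [Ix _] [Iy _]].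
- by move=> /IP.
- split; first exact: Iup.
  split; first exact: pos_rootD (IP _ Ix) Py Dxy.
  by rewrite ipE gt_eqF// ltr_wpDr ?Hroots_gt0// ip_theta_ge0.
- exact: Iab.
Qed.

(** A root orthogonal to [theta] is not dominant, hence can be raised by a simple
root; any other root [x] is raised to [theta] by the positive root [theta - x]. *)
Lemma ideal_theta I x : ideal_set I -> I x -> I theta.
Proof.
case=> IP Iup _; move: {2}(depth x).+1 (ltnSn (depth x)) => m.
elim: m x => // m IH x dx Ix; have px := IP _ Ix.
have [<-//|xt] := eqVneq x theta.
have [x0|x0] := eqVneq (ip x theta) 0.
  have [i xi] := not_dominant px x0.
  have n0 : x + e i != 0.
    apply/eqP => /(congr1 height); rewrite heightD height0 height_simple.
    by have := height_gt0 px; lra.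
  have De := pos_simple i.
  have Dx := root_add px.1 De.1 xi n0.
  apply: (IH (x + e i)); last exact: Iup.
  apply: leq_trans (depth_lt px (pos_rootD px De Dx) _) dx.
  by rewrite heightD height_simple ltrDl.
rewrite -(subrK x theta) addrC; apply: Iup => //; first exact: Hroots_sub.
by rewrite addrC subrK; exact: pos_theta.1.
Qed.

(** The ideal property forces [g] back only as the sum of a lower root of the
ideal and a positive root. *)
Lemma ideal_remove I g : ideal_set I ->
  (forall x, I x -> height x < height g -> ~ P (g - x)) ->
  ideal_set (I `\ g).
Proof.
case=> IP Iup Iab hg; split=> [x []|x y [Ix xg] Py Dxy|x y [Ix _] [Iy _]].
- by move=> /IP.
- split; first exact: Iup.
  move=> /= xyg; apply: (hg x Ix); rewrite -xyg.
    by rewrite heightD ltrDl height_gt0.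
  by rewrite addrC addKr.
- exact: Iab.
Qed.

Lemma exists_min_height (A : set V) x : A `<=` P -> A x ->
  exists2 g, A g & forall y, A y -> height g <= height y.
Proof.
move=> AP; move: {2}(Num.truncn (height x)).+1 (ltnSn (Num.truncn (height x))).
move=> m; elim: m x => // m IH x dx Ax.
have [[y [Ay yx]]|h] := pselect (exists y, A y /\ height y < height x).
  apply: (IH y) => //; rewrite ltnS in dx; apply: leq_trans dx.
  have hn z : A z -> height z \is a Num.nat by move=> /AP[_ /height_nat].
  have := height_lt (AP _ Ay).1 (AP _ Ax).1 yx.
  have /natrP[a ->] := hn _ Ay; have /natrP[b ->] := hn _ Ax.
  by rewrite !natrK natr1 ler_nat.
by exists x => // y Ay; rewrite leNgt; apply/negP => yx; apply: h; exists y.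
Qed.

(** The coordinates of a positive root are natural numbers bounded by the height
of [theta]. *)
Lemma roots_enum : exists rs : seq V, uniq rs /\ forall x, P x <-> x \in rs.
Proof.
pose N := (Num.truncn (height theta)).+1.
pose F (f : {ffun 'I_n -> 'I_N}) : V := \row_i (f i)%:R.
exists (undup [seq x <- [seq F f | f : {ffun 'I_n -> 'I_N}] | `[< P x >]]).
split=> [|x]; first exact: undup_uniq.
rewrite mem_undup mem_filter; split=> [px|/andP[/asboolP//]].
rewrite asboolT//; apply/mapP.
have xN i : (Num.truncn (x 0%R i) < N)%N.
  rewrite ltnS le_truncn//; apply: le_trans (theta_height px).
  rewrite /height (bigD1 i)//= lerDl sumr_ge0// => j _.
  exact: coord_ge0 px.2.
exists [ffun i => Ordinal (xN i)]; first exact: mem_enum.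
apply/rowP => i.
by rewrite mxE ffunE/= truncnK//; case: px => _ /root_le0P.
Qed.

(** There are finitely many positive roots, so that removing them one at a time
terminates. *)
Lemma root_set_ind (Q : set V -> Prop) :
  (forall A, (forall g, A g -> P g -> Q (A `\ g)) -> Q A) -> forall A, Q A.
Proof.
move=> step A; have [rs [_ rsP]] := roots_enum.
pose c (A : set V) := size [seq x <- rs | `[< A x >]].
move: {2}(c A).+1 (ltnSn (c A)) => m; elim: m A => // m IH A cA.
apply: step => g Ag pg; apply: IH; rewrite ltnS in cA.
apply: leq_trans cA; rewrite /c !size_filter.
have /rsP/perm_to_rem/seq.permP h := pg.
rewrite !h/= (asboolT Ag) asboolF ?add0n ?add1n ?ltnS; last by case.
by apply: sub_count => x /asboolP[? _]; apply/asboolP.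
Qed.

(** * Affine simple reflections *)

Local Notation hatV := (V * R^o * R^o)%type.
Local Notation a_ := (hat_simple theta).
Local Notation s_ := (hat_refl ip theta).
Local Notation form := (hatform ip).
Local Notation delta := (hat_delta R n).
Implicit Types (u v t : hatV) (w : seq (option 'I_n)) (i : option 'I_n).

(** The coefficients of delta and lambda are elements of the regular module; the
equations below place their sums and multiples in the field [R] itself. *)
Fact deltaD u v : (u + v).1.2 = u.1.2 + v.1.2 :> R. Proof. by []. Qed.
Fact deltaN u : (- u).1.2 = - u.1.2 :> R. Proof. by []. Qed.
Fact deltaZ (c : R) u : (c *: u).1.2 = c * u.1.2 :> R. Proof. by []. Qed.
Fact lambdaD u v : (u + v).2 = u.2 + v.2 :> R. Proof. by []. Qed.
Fact lambdaN u : (- u).2 = - u.2 :> R. Proof. by []. Qed.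
Fact lambdaZ (c : R) u : (c *: u).2 = c * u.2 :> R. Proof. by []. Qed.
Fact finD u v : (u + v).1.1 = u.1.1 + v.1.1. Proof. by []. Qed.
Fact finN u : (- u).1.1 = - u.1.1. Proof. by []. Qed.
Fact finZ (c : R) u : (c *: u).1.1 = c *: u.1.1. Proof. by []. Qed.

Definition levelE := (deltaD, deltaN, deltaZ, lambdaD, lambdaN, lambdaZ,
  finD, finN, finZ).

Lemma formC u v : form u v = form v u.
Proof. by rewrite /hatform (ipC ip u.1.1); ring. Qed.

Lemma formDl u v t : form (u + v) t = form u t + form v t.
Proof. by rewrite /hatform !levelE ipE; ring. Qed.

Lemma formZl c u t : form (c *: u) t = c * form u t.
Proof. by rewrite /hatform !levelE ipE; ring. Qed.

Lemma formNl u t : form (- u) t = - form u t.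
Proof. by rewrite -scaleN1r formZl mulN1r. Qed.

Lemma formBl u v t : form (u - v) t = form u t - form v t.
Proof. by rewrite formDl formNl. Qed.

Lemma formDr u v t : form t (u + v) = form t u + form t v.
Proof. by rewrite !(formC t) formDl. Qed.

Lemma formZr c u t : form t (c *: u) = c * form t u.
Proof. by rewrite !(formC t) formZl. Qed.

Lemma formNr u t : form t (- u) = - form t u.
Proof. by rewrite !(formC t) formNl. Qed.

Lemma formBr u v t : form t (u - v) = form t u - form t v.
Proof. by rewrite !(formC t) formBl. Qed.

Definition formE := (formBl, formBr, formDl, formDr, formNl, formNr, formZl, formZr).

Lemma form_hat x y : form (hat x) (hat y) = ip x y.
Proof. by rewrite /hatform /= !mul0r !addr0. Qed.

Definition finite_part i : V := if i is Some j then e j else - theta.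

Lemma finite_part_D i : D (finite_part i).
Proof.
case: i => [j|]; first exact: (pos_simple j).1.
exact: (rs_opp rsD pos_theta.1).
Qed.

Lemma simple_level0 i : (a_ i).2 = 0 :> R.
Proof. by case: i => [j|] //=; rewrite subr0. Qed.

Lemma simple_fin i : (a_ i).1.1 = finite_part i.
Proof. by case: i => [j|] //=; rewrite sub0r. Qed.

Lemma form_simple u i : u.2 = 0 :> R -> form u (a_ i) = ip u.1.1 (finite_part i).
Proof.
by move=> u0; rewrite /hatform u0 simple_level0 simple_fin mulr0 mul0r !addr0.
Qed.

Lemma form_simple_gt0 i : 0 < form (a_ i) (a_ i).
Proof.
rewrite form_simple ?simple_level0// simple_fin.
exact: ip_gt0 (rs_neq0 rsD (finite_part_D i)).
Qed.

Lemma hreflE i u : s_ i u = u - (2 * form u (a_ i) / form (a_ i) (a_ i)) *: a_ i.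
Proof. by rewrite /hat_refl /hat_co scalerA mulrCA mulrA. Qed.

Lemma hreflD i u v : s_ i (u + v) = s_ i u + s_ i v.
Proof. by rewrite !hreflE formDl mulrDr mulrDl scalerDl opprD addrACA. Qed.

Lemma hreflN i u : s_ i (- u) = - s_ i u.
Proof. by rewrite !hreflE formNl mulrN mulNr scaleNr opprD. Qed.

Lemma hrefl_form i u v : form (s_ i u) (s_ i v) = form u v.
Proof.
have h := form_simple_gt0 i.
rewrite !hreflE !formE (formC (a_ i) v); set c := form (a_ i) (a_ i).
by field; rewrite gt_eqF.
Qed.

Lemma hrefl_simple i : s_ i (a_ i) = - a_ i.
Proof.
rewrite hreflE mulfK; last by rewrite gt_eqF ?form_simple_gt0.
by rewrite scaler_nat mulr2n opprD addNKr.
Qed.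

Lemma hreflZ i c u : s_ i (c *: u) = c *: s_ i u.
Proof.
rewrite !hreflE formZl scalerBr scalerA; congr (_ - _ *: _).
by rewrite -!mulrA mulrCA.
Qed.

Lemma hreflK i : involutive (s_ i).
Proof.
move=> u; rewrite [s_ i u]hreflE hreflD hreflN hreflZ hrefl_simple scalerN opprK.
by rewrite hreflE subrK.
Qed.

Definition wact w : hatV -> hatV := foldr (fun i f => s_ i \o f) id w.

Lemma wact_cons i w u : wact (i :: w) u = s_ i (wact w u).
Proof. by []. Qed.

Lemma wact_cat w w' u : wact (w ++ w') u = wact w (wact w' u).
Proof. by elim: w => //= i w ->. Qed.

Lemma wactD w u v : wact w (u + v) = wact w u + wact w v.
Proof. by elim: w => //= i w ->; rewrite hreflD. Qed.

Lemma wactN w u : wact w (- u) = - wact w u.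
Proof. by elim: w => //= i w ->; rewrite hreflN. Qed.

Lemma wactZ w c u : wact w (c *: u) = c *: wact w u.
Proof. by elim: w => //= i w ->; rewrite hreflZ. Qed.

Lemma wactB w u v : wact w (u - v) = wact w u - wact w v.
Proof. by rewrite wactD wactN. Qed.

Lemma wact_form w u v : form (wact w u) (wact w v) = form u v.
Proof. by elim: w => //= i w <-; rewrite hrefl_form. Qed.

Lemma wact_rev w : cancel (wact w) (wact (rev w)).
Proof.
elim: w => // i w IH u.
by rewrite rev_cons -cats1 wact_cat /= hreflK IH.
Qed.

Lemma wact_revV w : cancel (wact (rev w)) (wact w).
Proof. by move=> u; have := wact_rev (rev w) u; rewrite revK. Qed.

Lemma hrefl_delta i : s_ i delta = delta.
Proof.
by rewrite hreflE form_simple// ip0l mulr0 mul0r scale0r subr0.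
Qed.

Lemma wact_delta w : wact w delta = delta.
Proof. by elim: w => //= i w ->; rewrite hrefl_delta. Qed.

(** * Real affine roots *)

Definition aroot u := [/\ D u.1.1, (u.1.2 : R) \is a Num.int & u.2 = 0 :> R].

(** The linear form that is 1 on every affine simple root: its sign on a real
affine root tells whether the root is positive. *)
Definition aheight u : R := height u.1.1 + u.1.2 * (1 + height theta).

Lemma aheightD u v : aheight (u + v) = aheight u + aheight v.
Proof. by rewrite /aheight !levelE heightD; ring. Qed.

Lemma aheightN u : aheight (- u) = - aheight u.
Proof. by rewrite /aheight !levelE heightN; ring. Qed.

Lemma aheightB u v : aheight (u - v) = aheight u - aheight v.
Proof. by rewrite aheightD aheightN. Qed.

Lemma aheight_simple i : aheight (a_ i) = 1.
Proof.
by case: i => [j|]; rewrite /aheight/= ?height_simple ?sub0r ?heightN; ring.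
Qed.

Lemma aroot_hat x : D x -> aroot (hat x).
Proof. by move=> Dx; split=> //=; rewrite rpred0. Qed.

Lemma aheight_hat x : aheight (hat x) = height x.
Proof. by rewrite /aheight /= mul0r addr0. Qed.

Lemma aroot_opp u : aroot u -> aroot (- u).
Proof.
case=> Du ku u0; split=> /=; [exact: (rs_opp rsD Du)|by rewrite rpredN|].
by rewrite u0 oppr0.
Qed.

Lemma aroot_simple i : aroot (a_ i).
Proof.
split; rewrite ?simple_level0 ?simple_fin//; first exact: finite_part_D.
by case: i => [j|] /=; rewrite ?subr0 ?rpred0 ?rpred1.
Qed.

Lemma aroot_refl i u : aroot u -> aroot (s_ i u).
Proof.
case=> Du ku u0; rewrite hreflE !form_simple ?simple_level0// simple_fin.
have [_ ki _] := aroot_simple i.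
split=> /=.
- by rewrite simple_fin; exact: (rs_refl rsD (finite_part_D i) Du).
- by rewrite rpredB// rpredM// (rs_int rsD (finite_part_D i) Du).
- by rewrite u0 simple_level0 scaler0 subr0.
Qed.

Lemma aroot_wact w u : aroot u -> aroot (wact w u).
Proof. by elim: w => //= i w IH /IH; exact: aroot_refl. Qed.

(** The coordinates in the basis of affine simple roots: since delta is the sum
of the affine simple root of index [None] and of [theta], its coefficient
contributes [theta] to the finite coordinates. *)
Definition acoord u i : R :=
  if i is Some j then u.1.1 0 j + u.1.2 * theta 0 j else u.1.2.

Lemma aheight_co u : aheight u = acoord u None + \sum_j acoord u (Some j).
Proof.
rewrite /aheight /acoord/= big_split/= -mulr_sumr -/(height _) -/(height theta).
by rewrite mulrDr mulr1 addrCA addrA.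
Qed.

Lemma form_co u : aroot u ->
  form u u = acoord u None * form u (a_ None)
             + \sum_j acoord u (Some j) * form u (a_ (Some j)).
Proof.
case=> _ _ u0; rewrite !form_simple// {1}/hatform u0 mul0r mulr0 !addr0.
rewrite {2}(simple_sum u.1.1) ipC ip_suml.
rewrite [X in _ = _ + X](eq_bigr (fun j => u.1.1 0 j * ip u.1.1 (e j)
    + u.1.2 * (theta 0 j * ip u.1.1 (e j)))); last first.
  by move=> j _; rewrite form_simple// /acoord/=; ring.
rewrite big_split/= -mulr_sumr.
have -> : \sum_j theta 0 j * ip u.1.1 (e j) = ip u.1.1 theta.
  rewrite [in RHS](simple_sum theta) ipC ip_suml.
  by apply: eq_bigr => j _; rewrite ipE ipC.
rewrite /acoord /= ipE mulrN addrCA addNr addr0.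
by apply: eq_bigr => j _; rewrite ipE ipC.
Qed.

(** The coordinates of a root lie between those of [- theta] and [theta], so they
take a common sign as soon as a nonzero multiple of [theta] is added. *)
Lemma acoord_sign u : aroot u ->
  (forall i, 0 <= acoord u i) \/ (forall i, acoord u i <= 0).
Proof.
case=> Du ku _; have th j := simple_le_theta j.
have [k0|k0|k0] := ltgtP u.1.2 0.
- right; case=> [j|]; last exact: ltW.
  have : u.1.2 <= -1.
    suff : 1 <= - (u.1.2 : R) by rewrite lerNr.
    by apply: int_ge1; rewrite ?rpredN// oppr_gt0.
  have /andP[_] := theta_coord j Du; have := th j.
  rewrite /acoord; nra.
- left; case=> [j|]; last exact: ltW.
  have : 1 <= u.1.2 by exact: int_ge1.
  have /andP[+ _] := theta_coord j Du; have := th j.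
  rewrite /acoord; nra.
- have [p|p] := pos_or_neg Du; [left|right] => -[j|] /=; rewrite /acoord k0//.
    by rewrite mul0r addr0 (coord_ge0 _ p.2).
  by rewrite mul0r addr0; have := coord_ge0 j p.2; rewrite mxE oppr_ge0.
Qed.

Lemma aheight_neq0 u : aroot u -> aheight u != 0.
Proof.
move=> ru; apply/eqP; suff : aheight u = 0 -> forall i, acoord u i = 0.
  move=> + h0 => /(_ h0) h; case: ru => Du _ _.
  have /eqP := rs_neq0 rsD Du; apply.
  apply/rowP => j; have := h (Some j); have := h None; rewrite /acoord mxE => ->.
  by rewrite mul0r addr0.
rewrite aheight_co => h0.
have [p|p] := acoord_sign ru.
  have sp : 0 <= \sum_j acoord u (Some j) by apply: sumr_ge0.
  have n0 : acoord u None = 0 by have := p None; lra.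
  have : \sum_j acoord u (Some j) = 0 by lra.
  move=> /psumr_eq0P h [j|//]; exact: h.
have sp : \sum_j acoord u (Some j) <= 0 by apply: sumr_le0.
have n0 : acoord u None = 0 by have := p None; lra.
have : \sum_j - acoord u (Some j) = 0 by rewrite sumrN; lra.
move=> /psumr_eq0P h [j|//]; apply: oppr_inj; rewrite oppr0; apply: h => // l _.
by rewrite oppr_ge0.
Qed.

Lemma aheight_sign u : aroot u -> 0 < aheight u \/ aheight u < 0.
Proof. by move/aheight_neq0; rewrite neq_lt => /orP[]; [right|left]. Qed.

Lemma acoord_ge0 u i : aroot u -> 0 < aheight u -> 0 <= acoord u i.
Proof.
move=> ru h; have [//|p] := acoord_sign ru.
move: h; rewrite aheight_co => h.
have : \sum_j acoord u (Some j) <= 0 by apply: sumr_le0.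
by have := p None; lra.
Qed.

Lemma aheight_gt0 u i : aroot u -> 0 < acoord u i -> 0 < aheight u.
Proof.
move=> ru h; have [//|h'] := aheight_sign ru.
have := acoord_ge0 i (aroot_opp ru); rewrite aheightN oppr_gt0 => /(_ h').
suff -> : acoord (- u) i = - acoord u i by lra.
by case: (i) => [j|] //=; rewrite /acoord /= mxE; ring.
Qed.

Lemma acoord_simple i k : acoord (a_ i) k = (i == k)%:R.
Proof.
case: i k => [i|] [k|] //=; rewrite /acoord /= ?mxE ?eqxx/=.
- by rewrite mul0r addr0 eq_sym.
- by rewrite !subr0; ring.
- by rewrite subr0.
Qed.

Lemma acoord_refl i k u : i != k -> acoord (s_ i u) k = acoord u k.
Proof.
move=> /negPf ik; rewrite hreflE; set c := _ / _.
have -> : acoord (u - c *: a_ i) k = acoord u k - c * acoord (a_ i) k.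
  by case: (k) => [j|]; rewrite /acoord !levelE ?mxE; ring.
by rewrite acoord_simple ik mulr0 subr0.
Qed.

(** A proper multiple of a simple root is not a root, and a proper multiple of
[theta] is not a root because it would exceed the highest root. *)
Lemma aroot_multiple u i : aroot u -> 0 < aheight u ->
  (forall k, k != i -> acoord u k = 0) -> u = a_ i.
Proof.
case: u => [[x k] l] [/= Dx ki l0] h0 h; rewrite {}l0 in h0 h *.
case: i h => [i|] h.
  have k0 : k = 0 by exact: (h None).
  rewrite {}k0 in ki h h0 *; congr (_, _, _).
  have xe : x = x 0 i *: e i.
    apply/rowP => j; rewrite !mxE eqxx/=.
    have [->|ji] := eqVneq j i; rewrite ?mulr1// mulr0.
    by have := h (Some j); rewrite /acoord/= mul0r addr0; apply.
  have [_ px] : P x by apply: pos_height => //; have := h0; rewrite /aheight/= mul0r addr0.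
  have /natrP[m xm] := proj1 (root_le0P x) px i.
  rewrite xe xm; have := Dx; rewrite xe xm => /(rs_reduced rsD) ->.
  by rewrite scale1r.
have xt : x = - k *: theta.
  apply/rowP => j; have := h (Some j) isT; rewrite /acoord/= !mxE; lra.
have tg : 0 < height theta by exact: height_gt0.
have kp : 0 < k.
  by move: h0; rewrite /aheight /= xt heightZ mulNr mulrDr mulr1 addrC addrK.
have k1 : k = 1.
  have /intrP[m km] := ki.
  have [m1|m1] := ltP 1 m; last first.
    by move: kp; rewrite km ltr0z => m0; have -> : m = 1 by lia.
  have k2 : 2 <= k by rewrite km (ler_int R 2 m); lia.
  have pkt : P (- x).
    have := pos_or_neg Dx; case=> // /height_gt0; rewrite xt heightZ; nra.
  have := theta_height pkt; rewrite heightN xt heightZ; nra.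
rewrite xt k1 scaleN1r -[RHS]/(0 - theta, (1 - 0 : R), (0 - 0 : R)).
by rewrite sub0r !subr0.
Qed.

(** A simple reflection changes only one coordinate, hence only makes its own
simple root negative. *)
Lemma hrefl_aheight i u : aroot u -> 0 < aheight u -> u != a_ i -> 0 < aheight (s_ i u).
Proof.
move=> ru hu; apply: contra_neqT => hs; apply: aroot_multiple => // k ki.
apply/eqP; rewrite eq_le acoord_ge0// andbT leNgt; apply: contra hs => hk.
apply: (@aheight_gt0 _ k); first exact: aroot_refl.
by rewrite acoord_refl// eq_sym.
Qed.

(** The exchange condition: the image of the simple root turns negative at some
letter, which can only be the reflection in the current image. *)
Lemma exchange w i : aheight (wact w (a_ i)) < 0 ->
  exists w1 j w2, w = w1 ++ j :: w2 /\ wact w2 (a_ i) = a_ j.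
Proof.
elim: w => [|j w IH]; first by rewrite /= aheight_simple ltr10.
have rw := aroot_wact w (aroot_simple i).
have [hp|/IH[w1 [k [w2 [-> h]]]] _] := aheight_sign rw; last first.
  by exists (j :: w1), k, w2.
move=> hn; exists [::], j, w; split=> //; apply/eqP.
by move: hn; apply: contraTT => wa; rewrite -leNgt ltW// hrefl_aheight.
Qed.

(** The last letter of a word makes its own simple root negative, so the other
letters must make it positive again; by the exchange condition the word then has
the same action as one with two letters less. *)
Lemma wact_pos_id w : (forall u, aroot u -> 0 < aheight u -> 0 < aheight (wact w u)) ->
  forall u, wact w u = u.
Proof.
move: {2}(size w).+1 (ltnSn (size w)) => m; elim: m w => // m IH w.
case/lastP: w => // w k; rewrite size_rcons -cats1 => sw wpos.
have := wpos _ (aroot_simple k).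
rewrite aheight_simple wact_cat /= hrefl_simple wactN aheightN.
move=> /(_ ltr01); rewrite oppr_gt0 => /exchange[w1 [j [w2 [wE w2k]]]].
have key u : wact (w ++ [:: k]) u = wact (w1 ++ w2) u.
  rewrite wE -catA cat_cons wact_cat [RHS]wact_cat wact_cons wact_cat wact_cons.
  congr (wact w1 _); rewrite -[wact [::] u]/u.
  by rewrite [s_ k u]hreflE wactB wactZ w2k hreflD hreflN hreflZ hrefl_simple
    scalerN opprK hreflE -!w2k !wact_form subrK.
suff h : forall u, wact (w1 ++ w2) u = u by move=> u; rewrite key h.
apply: IH => [|u ru hu]; last by rewrite -key wpos.
by move: sw; rewrite wE !size_cat/=; lia.
Qed.

(** An element of the affine Weyl group is determined by its inversions: under the
assumption the quotient of the two elements preserves the positive roots. *)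
Lemma wact_inj_pos w w' :
  (forall u, aroot u -> 0 < aheight u ->
     aheight (wact w u) < 0 <-> aheight (wact w' u) < 0) ->
  wact w = wact w'.
Proof.
move=> h; apply/funext => x.
suff /(_ (wact w x)) : forall u, wact (w' ++ rev w) u = u.
  by rewrite wact_cat wact_rev => ->.
apply: wact_pos_id => u ru hu; rewrite wact_cat.
have rv := aroot_wact (rev w) ru; have rv' := aroot_wact w' rv.
have [//|hn] := aheight_sign rv'; exfalso.
have [hv|hv] := aheight_sign rv.
  by have := proj2 (h _ rv hv) hn; rewrite wact_revV; lra.
have rN := aroot_opp rv.
have := h _ rN; rewrite aheightN oppr_gt0 => /(_ hv) [+ _].
by rewrite !wactN !aheightN wact_revV !oppr_lt0 => /(_ hu); lra.
Qed.

(** * Minuscule elements *)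

Definition delta_sub x : hatV := delta - hat x.
Definition rootlet_arg : hatV := 2 *: delta - hat theta.

Lemma hat_eq u v : u.1.1 = v.1.1 -> u.1.2 = v.1.2 :> R -> u.2 = v.2 :> R ->
  u = v.
Proof. by case: u v => [[x k] l] [[x' k'] l'] /= -> -> ->. Qed.

Lemma delta_subE x : delta_sub x = (- x, 1, 0).
Proof. by rewrite -[LHS]/(0 - x, (1 - 0 : R), (0 - 0 : R)) sub0r !subr0. Qed.

Lemma rootlet_argE : rootlet_arg = (- theta, 2, 0).
Proof.
rewrite -[LHS]/(2 *: 0 - theta, (2 * 1 - 0 : R), (2 * 0 - 0 : R)).
by rewrite scaler0 sub0r !subr0 mulr1 mulr0.
Qed.

Lemma delta_sub_inj : injective delta_sub.
Proof. by move=> x y; rewrite !delta_subE => -[/oppr_inj]. Qed.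

Lemma aroot_delta_sub x : D x -> aroot (delta_sub x).
Proof.
by move=> Dx; rewrite delta_subE; split; rewrite ?rpred1//; exact: (rs_opp rsD Dx).
Qed.

Lemma aheight_delta_sub x : D x -> 0 < aheight (delta_sub x).
Proof.
move=> Dx; rewrite delta_subE /aheight/= heightN mul1r.
have := height_gt0 pos_theta.
have [/theta_height|/height_gt0] := pos_or_neg Dx; rewrite ?heightN; lra.
Qed.

Lemma form_delta_sub_arg x : form (delta_sub x) rootlet_arg = ip x theta.
Proof. by rewrite delta_subE rootlet_argE /hatform/= !ipE opprK mulr0 mul0r !addr0. Qed.

(** The minuscule element with root set [I], given by a word. *)
Definition minuscule_word w (I : set V) := forall u, aroot u -> 0 < aheight u ->
  (aheight (wact w u) < 0 <-> exists2 x, I x & u = delta_sub x).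

Lemma minuscule_in w I x : minuscule_word w I -> D x ->
  (I x <-> aheight (wact w (delta_sub x)) < 0).
Proof.
move=> mw Dx; have h := mw _ (aroot_delta_sub Dx) (aheight_delta_sub Dx).
split=> [Ix|/h[y Iy]].
  by apply/h; exists x.
by move/delta_sub_inj ->.
Qed.

Lemma minuscule_inj w w' I : minuscule_word w I -> minuscule_word w' I ->
  wact w = wact w'.
Proof.
by move=> h h'; apply: wact_inj_pos => u ru hu; split=> [/(h _ ru hu)|/(h' _ ru hu)];
  [move/(h' _ ru hu)|move/(h _ ru hu)].
Qed.

(** A simple reflection exchanges two opposite roots and otherwise preserves the
sign of roots. *)
Lemma refl_sign i u : aroot u -> u != a_ i -> u != - a_ i ->
  aheight (s_ i u) < 0 <-> aheight u < 0.
Proof.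
move=> ru n1 n2; have [hu|hu] := aheight_sign ru.
  by split=> [h|]; [have := hrefl_aheight ru hu n1|]; lra.
have := @hrefl_aheight i _ (aroot_opp ru).
rewrite aheightN oppr_gt0 hreflN aheightN oppr_gt0.
by rewrite eqr_oppLR => /(_ hu n2) h; split.
Qed.

Lemma minuscule_add w I g i : I g -> D g -> minuscule_word w (I `\ g) ->
  wact w (delta_sub g) = a_ i ->
  minuscule_word (i :: w) I.
Proof.
move=> Ig Dg mw wg u ru hu.
have rw := aroot_wact w ru.
have [ug|ug] := eqVneq u (delta_sub g).
  split=> _; first by exists g.
  by rewrite wact_cons ug wg hrefl_simple aheightN aheight_simple; lra.
rewrite wact_cons refl_sign//.
- rewrite mw//; split=> -[x Ix ux]; exists x => //; first by case: Ix.
  by split=> // xg; rewrite ux xg eqxx in ug.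
- by apply: contra ug => /eqP; rewrite -wg => /(can_inj (wact_rev w)) ->.
- apply: contraTneq hu; rewrite -wg -wactN => /(can_inj (wact_rev w)) ->.
  by rewrite aheightN oppr_gt0 -leNgt ltW// aheight_delta_sub.
Qed.

Lemma minuscule_remove w I g i : D g -> minuscule_word w I ->
  wact w (delta_sub g) = - a_ i ->
  minuscule_word (i :: w) (I `\ g).
Proof.
move=> Dg mw wg u ru hu.
have rw := aroot_wact w ru.
have [ug|ug] := eqVneq u (delta_sub g).
  rewrite wact_cons ug wg hreflN hrefl_simple opprK aheight_simple.
  split=> [|[x [_ xg]]].
    by lra.
  by move/delta_sub_inj/esym/xg.
rewrite wact_cons refl_sign//.
- rewrite mw//; split=> -[x Ix ux]; exists x => //; last by case: Ix.
  by split=> // xg; rewrite ux xg eqxx in ug.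
- apply: contraTneq hu; rewrite -[a_ i]opprK -wg -wactN.
  move=> /(can_inj (wact_rev w)) ->.
  by rewrite aheightN oppr_gt0 -leNgt ltW// aheight_delta_sub.
- by apply: contra ug => /eqP; rewrite -wg => /(can_inj (wact_rev w)) ->.
Qed.

Lemma aheight_int u : aroot u -> aheight u \is a Num.int.
Proof.
case=> Du ku _; rewrite /aheight rpredD ?rpredM ?rpredD ?rpred1//.
  exact: height_int.
exact: height_int pos_theta.1.
Qed.

Lemma aheight_ge1 u : aroot u -> 0 < aheight u -> 1 <= aheight u.
Proof. by move=> /aheight_int; exact: int_ge1. Qed.

(** If [u] is negative then [- u = delta - x] with [x] in [I], and [g + x] is a
root, which contradicts commutativity. If both summands are positive, one of them
is a finite positive root [y] and the other is [delta - (g + y)], an inversion. *)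
Lemma minuscule_indecomposable w I g u v : ideal_set I -> I g ->
  minuscule_word w (I `\ g) -> aroot u -> aroot v -> u + v = delta_sub g ->
  0 < aheight (wact w u) -> 0 < aheight (wact w v) -> False.
Proof.
move=> [IP Iup Iab] Ig mw.
have neg u' v' : aroot u' -> aroot v' -> u' + v' = delta_sub g ->
    0 < aheight (wact w u') -> 0 < aheight u'.
  move=> ru rv uv hu; have [//|nu] := aheight_sign ru; exfalso.
  have := mw _ (aroot_opp ru); rewrite aheightN wactN aheightN oppr_gt0 oppr_lt0.
  move=> /(_ nu)[/(_ hu)[x [Ix _] ux] _].
  have ve : v' = delta_sub g + delta_sub x by rewrite -uv -ux addrAC subrr add0r.
  case: rv; rewrite ve !delta_subE /= -opprD => /(rs_opp rsD); rewrite opprK => Dgx _ _.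
  exact: Iab Ig Ix Dgx.
have pos u' v' : aroot u' -> aroot v' -> u' + v' = delta_sub g ->
    0 < aheight (wact w u') -> 0 < aheight (wact w v') ->
    0 < aheight u' -> u'.1.2 = 0 :> R -> False.
  move=> ru rv uv hu hv pu u0.
  have [Du _ u2] := ru; have ue : u' = hat u'.1.1.
    by case: (u') u0 u2 => -[x k] l /= -> ->.
  have pu1 : P u'.1.1.
    by apply: pos_height => //; rewrite -aheight_hat -ue.
  have ve : v' = delta_sub (g + u'.1.1).
    rewrite (canRL (addKr _) uv) {1}ue delta_subE [in RHS]delta_subE.
    rewrite -[LHS]/(- u'.1.1 - g, (- 0 + 1 : R), (- 0 + 0 : R)).
    by rewrite opprD addrC oppr0 !add0r.
  have Dgu : D (g + u'.1.1).
    by have [+ _ _] := rv; rewrite ve delta_subE/= => /(rs_opp rsD); rewrite opprK.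
  have /(minuscule_in mw Dgu) : (I `\ g) (g + u'.1.1).
    split; first exact: Iup.
    move=> /= gu; have := height_gt0 pu1.
    by rewrite -[u'.1.1](addKr g) gu addNr height0 ltxx.
  by rewrite -ve; lra.
move=> ru rv uv hu hv.
have pu := neg _ _ ru rv uv hu; have vu : v + u = delta_sub g by rewrite addrC.
have pv := neg _ _ rv ru vu hv.
have := congr1 (fun z : hatV => z.1.2 : R) uv; rewrite delta_subE !levelE /= => k1.
have := acoord_ge0 None ru pu; have := acoord_ge0 None rv pv; rewrite /acoord.
have [_ /intrP[a ua] _] := ru; have [_ /intrP[b vb] _] := rv.
move=> v0 u0; have [ua0|ua0] := eqVneq (u.1.2 : R) 0.
  exact: (pos _ _ ru rv).
apply: (pos _ _ rv ru) => //.
move: k1 u0 v0 ua0; rewrite ua vb -intrD -[1]/(1%:~R) => /intr_inj ab.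
by rewrite !ler0z intr_eq0 => a0 b0 /eqP an; have -> : b = 0 by lia.
Qed.

(** If the image [b] of [delta - g] were not simple, subtracting from it a simple
root at an acute angle would give a decomposition excluded by
[minuscule_indecomposable]. *)
Lemma minuscule_next w I g : ideal_set I -> I g -> minuscule_word w (I `\ g) ->
  exists i, wact w (delta_sub g) = a_ i.
Proof.
move=> idI Ig mw; have [IP _ _] := idI; have pg := IP _ Ig.
set b := wact w (delta_sub g).
have rb : aroot b by exact/aroot_wact/aroot_delta_sub/pg.1.
have hb : 0 < aheight b.
  have [//|/(minuscule_in mw pg.1)] := aheight_sign rb => -[_ /(_ erefl)[]].
have [i bi] : exists i, 0 < form b (a_ i).
  apply: contrapT => /forallNP h.
  have h' i : form b (a_ i) <= 0 by rewrite leNgt; apply/negP/h.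
  have : 0 < form b b.
    case: (rb) => Db _ b0; rewrite /hatform b0 mul0r mulr0 !addr0.
    exact: ip_gt0 (rs_neq0 rsD Db).
  rewrite form_co// => hp.
  have : acoord b None * form b (a_ None) <= 0.
    exact: mulr_ge0_le0 (acoord_ge0 None rb hb) (h' _).
  have : \sum_j acoord b (Some j) * form b (a_ (Some j)) <= 0.
    by apply: sumr_le0 => j _; apply: mulr_ge0_le0 (h' _); apply: acoord_ge0.
  by lra.
exists i; apply: contrapT => /eqP bni.
have [Db kb b0] := rb; have [Di ki i0] := aroot_simple i.
have bw : wact (rev w) b = delta_sub g by rewrite wact_rev.
have [be|be] := eqVneq b.1.1 (a_ i).1.1.
  (* Here b - a_i is a multiple of delta, so it is not a real root; instead the
     preimage of - a_i is an inversion that is not of the form delta - x. *)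
  have [k kE] : exists k : R, k = b.1.2 - (a_ i).1.2 by eexists.
  have bE : b = a_ i + k *: delta.
    apply: hat_eq; rewrite !levelE /=; first by rewrite be scaler0 addr0.
      by rewrite mulr1 kE subrKC.
    by rewrite b0 i0 mulr0 addr0.
  have kI : k \is a Num.int by rewrite kE rpredB.
  have hk : aheight b = 1 + k * (1 + height theta).
    by rewrite bE aheightD aheight_simple /aheight !levelE/= scaler0 height0 mulr1 add0r.
  have kn : k != 0 by apply: contraNneq bni => k0; rewrite bE k0 scale0r addr0.
  have ht := height_gt0 pos_theta.
  have k1 : 1 <= k.
    have [k0|k0] : 0 < k \/ k < 0 by move: kn; rewrite neq_lt => /orP[]; auto.
      exact: int_ge1.
    have : 1 <= - k by apply: int_ge1; rewrite ?rpredN// oppr_gt0.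
    by move=> k1; have : 0 <= (- k - 1) * (1 + height theta); [apply: mulr_ge0; lra|lra].
  have xE : - wact (rev w) (a_ i) = (g, k - 1, 0).
    have -> : wact (rev w) (a_ i) = delta_sub g - k *: delta.
      by rewrite -bw bE wactD wactZ wact_delta addrK.
    rewrite delta_subE.
    rewrite -[LHS]/(- (- g - k *: 0), (- (1 - k * 1) : R), (- (0 - k * 0) : R)).
    by rewrite scaler0 subr0 opprK mulr1 mulr0 subr0 oppr0 opprB.
  have rx : aroot (- wact (rev w) (a_ i)).
    exact/aroot_opp/aroot_wact/aroot_simple.
  have hx : aheight (wact w (- wact (rev w) (a_ i))) < 0.
    by rewrite wactN wact_revV aheightN aheight_simple oppr_lt0 ltr01.
  have px : 0 < aheight (- wact (rev w) (a_ i)).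
    rewrite xE /aheight/=; have := height_gt0 pg.
    have : 0 <= (k - 1) * (1 + height theta) by apply: mulr_ge0; lra.
    by lra.
  have [/(_ hx)[x [Ix _] ux] _] := mw _ rx px.
  move: ux; rewrite xE delta_subE => -[gx _].
  by have := height_gt0 pg; have := height_gt0 (IP _ Ix); rewrite gx heightN; lra.
have rc : aroot (b - a_ i).
  split; rewrite !levelE ?rpredB//; last by rewrite b0 i0 subr0.
  apply: root_sub => //; move: bi; rewrite form_simple// simple_fin//.
have hc : 0 < aheight (b - a_ i).
  have := aheight_neq0 rc; have := aheight_ge1 rb hb; rewrite aheightB aheight_simple.
  by rewrite lt_neqAle eq_sym => h ->; rewrite subr_ge0.
apply: (@minuscule_indecomposable w I g (wact (rev w) (a_ i))
  (wact (rev w) (b - a_ i))) => //.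
- exact/aroot_wact/aroot_simple.
- exact: aroot_wact.
- by rewrite -wactD addrC subrK.
- by rewrite wact_revV aheight_simple ltr01.
- by rewrite wact_revV.
Qed.

(** The root [delta - (x + y)] is the difference of a root that becomes negative
and of [y], which stays positive; and if [x + y] were a root for [x] and [y] in
[J], the sum [2 delta - (x + y)] would be an inversion. *)
Lemma minuscule_ideal w J : J `<=` P -> minuscule_word w J -> ideal_set J.
Proof.
move=> JP mw; split=> // [x y Jx Py Dxy|x y Jx Jy Dxy].
- apply/(minuscule_in mw Dxy).
  have -> : delta_sub (x + y) = delta_sub x - hat y.
    by rewrite !delta_subE; apply: hat_eq; rewrite !levelE/= ?opprD ?oppr0 ?addr0.
  rewrite wactB aheightB.
  have /(minuscule_in mw (JP _ Jx).1) hx := Jx.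
  have rh := aroot_hat Py.1.
  have [hy|hy] := aheight_sign (aroot_wact w rh); first by lra.
  have /mw := rh; rewrite aheight_hat => /(_ (height_gt0 Py))[/(_ hy)[z _]].
  rewrite delta_subE => -[_ /eqP]; by rewrite eq_sym oner_eq0.
- have /(minuscule_in mw (JP _ Jx).1) hx := Jx.
  have /(minuscule_in mw (JP _ Jy).1) hy := Jy.
  have dxyE : delta_sub x + delta_sub y = (- (x + y), 2, 0).
    by rewrite !delta_subE -[LHS]/(- x - y, (1 + 1 : R), (0 + 0 : R)) addr0 opprD.
  have rs : aroot (delta_sub x + delta_sub y).
    by rewrite dxyE; split=> //=; exact: (rs_opp rsD Dxy).
  have hp : 0 < aheight (delta_sub x + delta_sub y).
    by rewrite aheightD addr_gt0// aheight_delta_sub//;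
      [exact: (JP _ Jx).1|exact: (JP _ Jy).1].
  have [+ _] := mw _ rs hp; rewrite wactD aheightD => /(_ ltac:(lra))[z _].
  by rewrite dxyE delta_subE => -[_ /eqP]; rewrite (eqr_nat _ 2 1).
Qed.

(** * Rootlets *)

Implicit Type q : seq 'I_n.

Definition fin_word q := map (@Some 'I_n) q.
(** Words for products v s_0 with v in the finite Weyl group. *)
Definition fin_word0 q := fin_word q ++ [:: None].

Lemma fin_word0_cons (i : 'I_n) q : fin_word0 (i :: q) = Some i :: fin_word0 q.
Proof. by []. Qed.

Lemma wact_fin_word0 q u : wact (fin_word0 q) u = wact (fin_word q) (s_ None u).
Proof. by rewrite wact_cat. Qed.

Lemma hrefl_hat (i : 'I_n) x :
  s_ (Some i) (hat x) = hat (x - cartan ip x (e i) *: e i).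
Proof.
rewrite hreflE !form_hat -/(cartan ip x (e i)).
by apply: hat_eq; rewrite !levelE //= mulr0 subr0.
Qed.

Lemma fin_word_level q u : (wact (fin_word q) u).1.2 = u.1.2 :> R.
Proof.
elim: q => // i q IH; rewrite -[fin_word (i :: q)]/(Some i :: fin_word q).
rewrite wact_cons hreflE.
by rewrite !levelE IH /= mulr0 subr0.
Qed.

Lemma fin_word_rev q : rev (fin_word q) = fin_word (rev q).
Proof. by rewrite /fin_word map_rev. Qed.

Lemma fin_word_hat q x : D x -> exists2 y, D y & wact (fin_word q) (hat x) = hat y.
Proof.
move=> Dx; have [Dy _ y2] := aroot_wact (fin_word q) (aroot_hat Dx).
exists (wact (fin_word q) (hat x)).1.1 => //.
by apply: hat_eq => //; rewrite fin_word_level.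
Qed.

Lemma hrefl0_arg : s_ None rootlet_arg = hat theta.
Proof.
have t0 := ip_theta_gt0.
rewrite hreflE !form_simple ?simple_level0// ?simple_fin; last first.
  by rewrite rootlet_argE.
rewrite rootlet_argE /= !ipE opprK mulfK ?gt_eqF// -/(delta_sub theta) delta_subE.
apply: hat_eq; rewrite !levelE/= ?mulr1 ?subrr ?mulr0 ?subr0//.
by rewrite scalerN opprK scaler_nat mulr2n addKr.
Qed.

Lemma hat_inj x y : hat x = hat y -> x = y.
Proof. by case. Qed.

Context (long_theta : long theta).

Lemma hrefl0_delta_sub x : H x -> x != theta -> s_ None (delta_sub x) = hat (theta - x).
Proof.
move=> hx xt; have t0 := ip_theta_gt0.
have c : ip x theta = ip theta theta / 2 by exact: Hroots_cartan.
rewrite hreflE !form_simple ?simple_level0// ?simple_fin; last by rewrite delta_subE.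
rewrite delta_subE /= !ipE !opprK c -/(delta_sub theta) delta_subE.
have -> : 2 * (ip theta theta / 2) / ip theta theta = 1.
  by field; rewrite gt_eqF.
rewrite scale1r; apply: hat_eq; rewrite !levelE/= ?subrr ?subr0//.
by rewrite opprK addrC.
Qed.

Lemma minuscule_None : minuscule_word [:: None] [set theta].
Proof.
apply: (@minuscule_add [::] _ theta None) => //; first exact: pos_theta.1.
by move=> u ru hu; split=> [/=|[x [/= ->]]//]; lra.
Qed.

(** Building the ideal from the top, each new letter is a finite one: its simple
root has inner product (g, theta) > 0 with the current rootlet, a positive root,
whereas the finite part [- theta] of the affine simple root has inner product at
most 0 with every positive root. *)
Lemma finite_minuscule I : ideal_set I -> I `<=` H -> I theta ->
  exists q mu, [/\ minuscule_word (fin_word0 q) I, P mu &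
    wact (fin_word0 q) rootlet_arg = hat mu].
Proof.
apply: (root_set_ind (Q := fun I => ideal_set I -> I `<=` H -> I theta ->
  exists q mu, [/\ minuscule_word (fin_word0 q) I, P mu &
    wact (fin_word0 q) rootlet_arg = hat mu])).
move=> {}I IH idI IH' It; have [IP Iup Iab] := idI.
have [g Ig gmin] := exists_min_height IP It.
have [gt|gt] := eqVneq g theta.
  have -> : I = [set theta].
    apply/seteqP; split=> [x Ix /=|_ ->//].
    by apply: theta_eq; [exact: IP|rewrite -gt gmin].
  by exists [::], theta; split; [exact: minuscule_None| |exact: hrefl0_arg].
have pg := IP _ Ig.
have idI' : ideal_set (I `\ g).
  by apply: ideal_remove => // x /gmin; rewrite leNgt => /negP.
have [||q [mu [mv pm tm]]] := IH g Ig pg idI'.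
- by move=> x [/IH'].
- by split=> //= tg; rewrite tg eqxx in gt.
have [i wi] := minuscule_next idI Ig mv.
have gt0 : 0 < ip g theta := Hroots_gt0 (IH' _ Ig).
have : form (hat mu) (a_ i) = ip g theta.
  by rewrite -tm -wi wact_form formC form_delta_sub_arg.
rewrite form_simple//=; case: i wi => [i|] wi /= fi; last first.
  by have := ip_theta_ge0 pm; rewrite -[ip mu theta]opprK -ipNr fi; lra.
exists (i :: q), (mu - cartan ip mu (e i) *: e i); split.
- by rewrite fin_word0_cons; exact: minuscule_add pg.1 mv wi.
- apply: refl_pos => //; apply/eqP => mi.
  have /(can_inj (wact_rev _)) : 
      wact (fin_word0 q) rootlet_arg = wact (fin_word0 q) (delta_sub g).
    by rewrite tm wi mi.
  by rewrite rootlet_argE delta_subE => -[_ /eqP]; rewrite (eqr_nat _ 2 1).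
- by rewrite fin_word0_cons wact_cons tm hrefl_hat.
Qed.

(** The roots of [I] outside [H] are added one at a time. Each of them
contributes a letter whose simple root is orthogonal to the rootlet, because the
added root is orthogonal to [theta]; so the rootlet does not change. *)
Lemma ideal_minuscule I : ideal_set I -> I theta ->
  exists w q mu, [/\ minuscule_word w I, minuscule_word (fin_word0 q) (I `&` H), P mu,
    wact w rootlet_arg = hat mu & wact (fin_word0 q) rootlet_arg = hat mu].
Proof.
apply: (root_set_ind (Q := fun I => ideal_set I -> I theta ->
  exists w q mu, [/\ minuscule_word w I, minuscule_word (fin_word0 q) (I `&` H), P mu,
    wact w rootlet_arg = hat mu & wact (fin_word0 q) rootlet_arg = hat mu])).
move=> {}I IH idI It; have [IP Iup Iab] := idI.
have [IH'|] := pselect (I `<=` H).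
  have [q [mu [mv pm tm]]] := finite_minuscule idI IH' It.
  exists (fin_word0 q), q, mu; split=> //.
  by have /setIidl -> := IH'.
move=> /existsNP[x0 /not_implyP Ix0].
have sub : I `\` H `<=` P by move=> x [/IP].
have [g [Ig nHg] gmin] := exists_min_height sub Ix0.
have pg := IP _ Ig.
have g0 : ip g theta = 0.
  by apply/eqP; apply: contrapT => /negP g0; apply: nHg.
have idI' : ideal_set (I `\ g).
  apply: ideal_remove => // x Ix xg pgx.
  have hx : H x.
    by apply: contrapT => nH; have := gmin x (conj Ix nH); rewrite leNgt xg.
  have := Hroots_gt0 hx; have := ip_theta_ge0 pgx; rewrite ipE g0; lra.
have [|w [q [mu [mw mv pm tw tv]]]] := IH g Ig pg idI'.
  split=> //= tg; move: g0; rewrite -tg => /eqP; rewrite gt_eqF//.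
  exact: ip_theta_gt0.
have [i wi] := minuscule_next idI Ig mw.
exists (i :: w), q, mu; split=> //.
- exact: minuscule_add pg.1 mw wi.
- have <- // : (I `\ g) `&` H = I `&` H.
  apply/seteqP; split=> [x [[Ix _] hx]//|x [Ix hx]]; split=> //; split=> //.
  by move=> /= xg; apply: nHg; rewrite -xg.
- have f0 : form (hat mu) (a_ i) = 0.
    by rewrite -tw -wi wact_form formC form_delta_sub_arg.
  by rewrite wact_cons tw hreflE f0 mulr0 mul0r scale0r subr0.
Qed.

(** For v s_0 with v theta = mu, the finite root v^-1 z has positive inner product
with [theta], hence lies in [H], and s_0 takes it to [delta - g] with
[g = theta - v^-1 z]. *)
Lemma fin_word0_root q mu z : wact (fin_word0 q) rootlet_arg = hat mu ->
  D z -> 0 < ip z mu -> z != mu -> exists2 g, P g & wact (fin_word0 q) (delta_sub g) = hat z.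
Proof.
move=> tm Dz zm zn.
have vt : wact (fin_word q) (hat theta) = hat mu by rewrite -hrefl0_arg -wact_fin_word0.
have [y Dy yz] := fin_word_hat (rev q) Dz; rewrite -fin_word_rev in yz.
have yz' : wact (fin_word q) (hat y) = hat z by rewrite -yz wact_revV.
have yt : 0 < ip y theta.
  by rewrite -form_hat -(wact_form (fin_word q)) yz' vt form_hat.
have py : P y.
  by have [//|/ip_theta_ge0] := pos_or_neg Dy; rewrite ipE; lra.
have hy : H y by split=> //; rewrite gt_eqF.
have ny : y != theta.
  by apply: contra_neq zn => yt'; apply: hat_inj; rewrite -yz' yt' vt.
have pg := Hroots_sub hy ny.
have c : ip y theta = ip theta theta / 2 by exact: Hroots_cartan.
have t0 := ip_theta_gt0.
have hg : H (theta - y) by split=> //; rewrite ipE c gt_eqF//; lra.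
exists (theta - y) => //; rewrite wact_fin_word0 hrefl0_delta_sub// ?subKr//.
rewrite -subr_eq0 addrAC subrr add0r oppr_eq0.
exact: (rs_neq0 rsD Dy).
Qed.

(** If v fixes [theta], it preserves the sign of the roots not orthogonal to
[theta]. *)
Lemma fin_word0_theta q J : J `<=` H -> minuscule_word (fin_word0 q) J ->
  wact (fin_word0 q) rootlet_arg = hat theta -> J = [set theta].
Proof.
move=> JH mv tm.
have vt : wact (fin_word q) (hat theta) = hat theta.
  by rewrite -{1}hrefl0_arg -wact_fin_word0.
apply/seteqP; split=> [x Jx /=|_ ->].
  apply: contrapT => /eqP xt; have hx := JH _ Jx; have px := hx.1.
  have Ds : D (theta - x) := (Hroots_sub hx xt).1.
  have /(minuscule_in mv px.1) := Jx; rewrite wact_fin_word0 hrefl0_delta_sub//.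
  have [y Dy vy] := fin_word_hat q Ds; rewrite vy aheight_hat => y0.
  have : 0 < ip y theta.
    rewrite -form_hat -vy -{1}vt wact_form form_hat ipE (Hroots_cartan long_theta hx xt).
    by have := ip_theta_gt0; lra.
  have py : P (- y).
    by apply: pos_height; [exact: (rs_opp rsD Dy)|rewrite heightN oppr_gt0].
  by have := ip_theta_ge0 py; rewrite ipE; lra.
apply/(minuscule_in mv pos_theta.1).
rewrite wact_fin_word0 (hrefl_simple None) wactN aheightN oppr_lt0.
apply: (@aheight_gt0 _ None); first exact: aroot_wact (aroot_simple None).
by rewrite /acoord fin_word_level /= subr0 ltr01.
Qed.

Lemma pos_root_opp x : P x -> ~ P (- x).
Proof. by move=> /height_gt0 h /height_gt0; rewrite heightN; lra. Qed.

(** By [fin_word0_root] the negative root [- alpha_i] is the image of some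
[delta - g], so the reflection removes [g] from the root set. *)
Lemma fin_word0_step q J mu (i : 'I_n) :
  wact (fin_word0 q) rootlet_arg = hat mu -> P mu -> ip mu (e i) < 0 ->
  J `<=` H -> minuscule_word (fin_word0 q) J ->
  exists2 J', J' `<=` H & minuscule_word (fin_word0 (i :: q)) J'.
Proof.
move=> tm pm mi JH mv.
have [g pg wg] : exists2 g, P g & wact (fin_word0 q) (delta_sub g) = hat (- e i).
  apply: (fin_word0_root tm); first exact: (rs_opp rsD (pos_simple i).1).
    by rewrite ipE ipC oppr_gt0.
  apply: contraPneq pm => <- /pos_root_opp; rewrite opprK; apply; exact: pos_simple.
exists (J `\ g); first by move=> x [/JH].
apply: minuscule_remove => //; first exact: pg.1.
by rewrite wg; apply: hat_eq; rewrite !levelE/= ?oppr0.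
Qed.

(** Induction along [long_ind]: when the rootlet makes an obtuse angle with a
simple root, both elements can be shortened by the same reflection. *)
Lemma rootlet_inj mu : P mu -> long mu -> forall q q' J J',
  J `<=` H -> J' `<=` H -> minuscule_word (fin_word0 q) J ->
  minuscule_word (fin_word0 q') J' ->
  wact (fin_word0 q) rootlet_arg = hat mu -> wact (fin_word0 q') rootlet_arg = hat mu ->
  wact (fin_word0 q) = wact (fin_word0 q').
Proof.
apply: (long_ind (Q := fun mu => forall q q' J J',
  J `<=` H -> J' `<=` H -> minuscule_word (fin_word0 q) J ->
  minuscule_word (fin_word0 q') J' ->
  wact (fin_word0 q) rootlet_arg = hat mu -> wact (fin_word0 q') rootlet_arg = hat mu ->
  wact (fin_word0 q) = wact (fin_word0 q'))).
  move=> q q' J J' JH JH' mv mv' tv tv'.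
  have JE := fin_word0_theta JH mv tv; have JE' := fin_word0_theta JH' mv' tv'.
  by apply: (minuscule_inj mv); rewrite JE -JE'.
move=> {}mu i pm lm mi IH q q' J J' JH JH' mv mv' tv tv'.
have [K KH mK] := fin_word0_step tv pm mi JH mv.
have [K' KH' mK'] := fin_word0_step tv' pm mi JH' mv'.
have tK p : wact (fin_word0 p) rootlet_arg = hat mu ->
    wact (fin_word0 (i :: p)) rootlet_arg = hat (mu - cartan ip mu (e i) *: e i).
  by move=> tu; rewrite fin_word0_cons wact_cons tu hrefl_hat.
have := IH _ _ _ _ KH KH' mK mK' (tK _ tv) (tK _ tv').
move=> E; apply/funext => u; apply: (can_inj (hreflK (Some i))).
by rewrite -!wact_cons -!fin_word0_cons E.
Qed.

(** The same induction, lengthening the element: if [mu] makes an obtuse angle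
with a simple root, its reflection makes an acute angle with it, and
[fin_word0_root] provides the root to add. *)
Lemma rootlet_surj mu : P mu -> long mu -> exists q J,
  [/\ J `<=` H, J theta, minuscule_word (fin_word0 q) J &
    wact (fin_word0 q) rootlet_arg = hat mu].
Proof.
apply: (long_ind (Q := fun mu => exists q J,
  [/\ J `<=` H, J theta, minuscule_word (fin_word0 q) J &
    wact (fin_word0 q) rootlet_arg = hat mu])).
  exists [::], [set theta]; split=> //; [|exact: minuscule_None|exact: hrefl0_arg].
  by move=> _ ->; exact: Hroots_theta.
move=> {}mu i pm lm mi [q [J [JH Jt mv tm]]].
have De := (pos_simple i).1; have ei := ip_gt0 ip (rs_neq0 rsD De).
set nu := mu - _ in tm.
have muE : s_ (Some i) (hat nu) = hat mu by rewrite -hrefl_hat hreflK.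
have [g pg wg] : exists2 g, P g & wact (fin_word0 q) (delta_sub g) = hat (e i).
  apply: (fin_word0_root tm) => //.
    rewrite -form_hat -(hrefl_form (Some i)) muE (hrefl_simple (Some i)) formNl.
    by rewrite form_hat ipC oppr_gt0.
  apply: contraPneq pm => en; have := muE; rewrite -en (hrefl_simple (Some i)).
  have -> : - a_ (Some i) = hat (- e i).
    by apply: hat_eq; rewrite !levelE/= ?oppr0.
  by move=> /hat_inj <-; exact: pos_root_opp (pos_simple i).
have ng : ~ J g.
  by move=> /(minuscule_in mv pg.1); rewrite wg aheight_hat height_simple; lra.
exists (i :: q), (g |` J); split.
- move=> x [->|/JH//]; split=> //.
  rewrite -form_delta_sub_arg -(wact_form (fin_word0 q)) wg tm form_hat gt_eqF//.
  rewrite -form_hat -(hrefl_form (Some i)) muE (hrefl_simple (Some i)) formNl.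
  by rewrite form_hat ipC oppr_gt0.
- by right.
- rewrite fin_word0_cons; apply: (@minuscule_add _ _ g (Some i)) => //;
    [by left|exact: pg.1|].
  suff -> : (g |` J) `\ g = J by [].
  apply/seteqP; split=> [x [[->|//] /(_ erefl)[]]|x Jx]; split; first by right.
  by move=> /= xg; apply: ng; rewrite -xg.
- by rewrite fin_word0_cons wact_cons tm.
Qed.

End FiniteRoots.

(** * Traces, subspaces and the adjoint representation *)

(** The matrix is diagonalizable with real eigenvalues, and the trace of its square
is the sum of their squares. *)
Lemma mxtrace_sq_eq0 (C : numClosedFieldType) n (A : 'M[C]_n) (rs : seq C) :
  uniq rs -> {in rs, forall r, r \is Num.real} ->
  (1%:M <= \sum_(r <- rs) eigenspace A r)%MS -> \tr (A *m A) = 0 -> A = 0.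
Proof.
case: n A => [|n] A urs irs full trA; first by apply/matrixP => -[].
have /diagonalizablePeigen[P Pu PA] : exists2 rs : seq C, uniq rs &
    (\sum_(r <- rs) eigenspace A r :=: 1%:M)%MS.
  by exists rs => //; apply/eqmxP; rewrite submx1.
have dvdA : mxminpoly A %| \prod_(r <- rs) ('X - r%:P).
  apply: mxminpoly_min.
  have cop (i j : 'I_(size rs)) : j != i ->
      coprimep ('X - (rs`_i)%:P) ('X - (rs`_j)%:P).
    by move=> ij; rewrite coprimep_XsubC root_XsubC nth_uniq// eq_sym.
  have E := @kermxpoly_prod _ _ A _ predT _ (fun i j _ _ => @cop i j).
  have -> : \prod_(r <- rs) ('X - r%:P) = \prod_(i < size rs) ('X - (rs`_i)%:P).
    by rewrite (big_nth 0) big_mkord.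
  apply/eqP; rewrite -[horner_mx _ _]mul1mx -sub_kermx.
  apply: submx_trans full _; rewrite (big_nth 0) big_mkord.
  rewrite (eq_bigr (fun i : 'I_(size rs) => kermxpoly A ('X - (rs`_i)%:P))).
    by rewrite -E submx_refl.
  by move=> i _; rewrite eigenspace_poly.
have /similar_diagPex[d /(similarP Pu) PAd] := PA.
have AE : A = invmx P *m diag_mx d *m P by rewrite -mulmxA -PAd mulKmx.
have d_real i : d 0 i \is Num.real.
  have /dvdpP[q qE] := dvdA.
  apply: irs; rewrite -root_prod_XsubC qE rootM; apply/orP; right.
  rewrite -eigenvalue_root_min; apply/eigenvalueP; exists (row i P).
    by rewrite -row_mul PAd row_mul row_diag_mx -scalemxAl -rowE.
  apply: contraTneq Pu => Pi0; rewrite -row_free_unit.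
  apply/row_freePn; exists i; by rewrite Pi0 sub0mx.
have sum0 : \sum_i d 0 i ^+ 2 = 0.
  rewrite -[RHS]trA [in RHS]AE !mulmxA mulmxK// mxtrace_mulC !mulmxA mulmxV//.
  rewrite mul1mx mulmx_diag mxtrace_diag.
  by apply: eq_bigr => i _; rewrite mxE expr2.
suff d0 : d = 0 by rewrite AE d0 linear0 mulmx0 mul0mx.
apply/rowP => i; rewrite mxE; apply/eqP; rewrite -sqrf_eq0; apply/eqP.
by apply: (psumr_eq0P _ sum0) => // j _; rewrite -realEsqr.
Qed.

Section LieAlgebra.
Import VectorInternalTheory.
Context (R : realType) (g : vectType R[i]) (br : {bilinear g -> g -> g}).
Local Notation C := (R[i]).

Lemma brDl x y z : br (x + y) z = br x z + br y z.
Proof. by rewrite linearDl. Qed.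
Lemma brDr x y z : br z (x + y) = br z x + br z y.
Proof. by rewrite linearDr. Qed.
Lemma brZl a x z : br (a *: x) z = a *: br x z.
Proof. by rewrite linearZl. Qed.
Lemma brZr a x z : br z (a *: x) = a *: br z x.
Proof. by rewrite linearZr. Qed.
Lemma br0l z : br 0 z = 0. Proof. by rewrite linear0l. Qed.
Lemma br0r z : br z 0 = 0. Proof. by rewrite linear0r. Qed.
Lemma brNl x z : br (- x) z = - br x z. Proof. by rewrite linearNl. Qed.
Lemma brNr x z : br z (- x) = - br z x. Proof. by rewrite linearNr. Qed.

Definition admx x := f2mx (linfun (br x)).

Lemma admxE x y : v2r (br x y) = v2r y *m admx x.
Proof.
by rewrite -[br x y](lfunE (br x)) [in LHS]unlock /= r2vK.
Qed.

(** A subspace of maximal dimension among those on which [P] holds contains every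
vector satisfying [P]. *)
Lemma vspace_of (P : g -> Prop) : P 0 ->
  (forall a x y, P x -> P y -> P (a *: x + y)) ->
  exists U : {vspace g}, forall x, x \in U <-> P x.
Proof.
move=> P0 Plin.
suff step m (U : {vspace g}) : (\dim {:g} - \dim U < m)%N ->
    (forall x, x \in U -> P x) ->
    exists U : {vspace g}, forall x, x \in U <-> P x.
  by apply: (step _ 0%VS (ltnSn _)) => x; rewrite memv0 => /eqP ->.
elim: m U => // m IH U dU UP.
have [h|] := pselect (forall x, P x -> x \in U).
  by exists U => x; split; [exact: UP|exact: h].
move=> /existsNP[x /not_implyP[Px /negP xU]].
apply: (IH (U + <[x]>)%VS); last first.
  move=> _ /memv_addP[u /UP Pu [_ /vlineP[k ->] ->]].
  by rewrite addrC; exact: Plin.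
have Ux : (U <= U + <[x]>)%VS by rewrite addvSl.
have lt : (\dim U < \dim (U + <[x]>))%N.
  rewrite ltn_neqAle dimvS// andbT; apply: contra xU => /eqP dE.
  have /eqP -> : U == (U + <[x]>)%VS by rewrite eqEdim Ux dE leqnn.
  by have := memv_add (mem0v U) (memv_line x); rewrite add0r.
by have := dimvS (subvf (U + <[x]>)%VS); move: lt dU; lia.
Qed.

(** * Weights in a simple Lie algebra *)

Section Cartan.
Context (t : {vspace g}) (n : nat) (alpha : 'I_n -> dual t).
Context (simple_g : simple_lie br) (tri : triangular_decomposition br alpha).
Local Notation D := (dual t).
Local Notation rsp := (root_space br).
Implicit Types (l a b : D) (h : subvs_of t).

Lemma brC x y : br x y = - br y x.
Proof.
have [[alt _] _ _] := simple_g; apply/eqP; rewrite -addr_eq0.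
by have := alt (x + y); rewrite brDl !brDr !alt add0r addr0 => ->.
Qed.

Lemma br_self x : br x x = 0.
Proof. by have [[-> _] _ _] := simple_g. Qed.

Lemma jacobi x y z : br x (br y z) = br (br x y) z + br y (br x z).
Proof.
have [[_ jac] _ _] := simple_g; have := jac x y z.
rewrite (brC z (br x y)) (brC z x) brNr -addrA -opprD => /subr0_eq ->.
by rewrite addrC.
Qed.

Lemma root_spaceD l x y : rsp l x -> rsp l y -> rsp l (x + y).
Proof. by move=> hx hy h; rewrite brDr hx hy scalerDr. Qed.

Lemma root_spaceZ l c x : rsp l x -> rsp l (c *: x).
Proof. by move=> hx h; rewrite brZr hx !scalerA mulrC. Qed.

Lemma root_space0v l : rsp l 0.
Proof. by move=> h; rewrite br0r scaler0. Qed.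

Lemma root_spaceN l x : rsp l x -> rsp l (- x).
Proof. by rewrite -scaleN1r; exact: root_spaceZ. Qed.

Lemma root_space_br a b x y : rsp a x -> rsp b y -> rsp (a + b) (br x y).
Proof.
move=> hx hy h; rewrite jacobi hx hy brZl brZr -scalerDl.
by rewrite add_lfunE.
Qed.

Lemma root_space_0 x : rsp (0 : D) x <-> x \in t.
Proof.
have [tP _ _] := tri; split=> [h0|/tP h0 h].
  apply/tP => h ht; have := h0 (Subvs ht).
  by rewrite /= zero_lfunE scale0r.
by rewrite h0 ?subvsP// zero_lfunE scale0r.
Qed.

(** Every vector is a sum of weight vectors, by the triangular decomposition. *)
Lemma weight_ind (P : g -> Prop) : P 0 ->
  (forall k x y, P x -> P y -> P (k *: x + y)) ->
  (forall l x, rsp l x -> P x) -> forall x, P x.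
Proof.
move=> P0 Plin Pw x; have [U UP] := vspace_of P0 Plin.
have [_ _ /(_ x)[[[u h] v] [[/= uu ht vv ->] _]]] := tri.
apply/UP; rewrite !rpredD//.
- by apply: uu => y [z _] /Pw; rewrite UP.
- by apply/UP; apply: (Pw (0 : D)); apply/root_space_0.
- by apply: vv => y [z _] /Pw; rewrite UP.
Qed.

Definition weight l := exists2 x, x != 0 & rsp l x.

Lemma weightP l : weight l -> l = 0 \/ root_functional br l.
Proof. by move=> wl; have [->|l0] := eqVneq l 0; [left|right]. Qed.

Lemma weight_root l : weight l -> l != 0 -> root_functional br l.
Proof. by []. Qed.

Lemma alpha_free (k : 'I_n -> C) : \sum_i k i *: alpha i = 0 -> forall i, k i = 0.
Proof.
have [_ [fr _ _] _] := tri.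
have /freeP fr' : free (map_tuple alpha (ord_tuple n)) by exact: fr.
move=> h; apply: fr'; rewrite -[RHS]h; apply: eq_bigr => i _; congr (_ *: _).
by rewrite -(tnth_nth 0) tnth_map tnth_ord_tuple.
Qed.

(** The simple roots are linearly independent forms on [t], so their values can
be prescribed. Such an element grades the roots by their heights. *)
Lemma exists_principal : exists h : subvs_of t, forall i, alpha i h = 1.
Proof.
pose X := vbasis {:subvs_of t}.
pose A := \matrix_(k < \dim {:subvs_of t}, i < n) (alpha i X`_k : C).
have /row_freeP[B AB] : row_free A^T.
  apply: inj_row_free => v vA.
  have v0 : forall i, v 0 i = 0.
    apply: alpha_free; apply/lfunP => h; rewrite (coord_vbasis (memvf h)) !linear_sum.
    apply: eq_bigr => k _; rewrite !linearZ; congr (_ *: _).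
    have := congr1 (fun M : 'rV_ _ => M 0 k) vA; rewrite !mxE => vAk.
    rewrite /= zero_lfunE sum_lfunE -[RHS]vAk; apply: eq_bigr => i _.
    by rewrite scale_lfunE !mxE.
  by apply/rowP => i; rewrite v0 mxE.
pose w := \row_i (1 : C) *m B^T.
exists (\sum_k w 0 k *: X`_k) => i; rewrite linear_sum.
have : w *m A = \row_i 1.
  by rewrite /w -mulmxA -[A]trmxK -trmx_mul AB trmx1 mulmx1.
move=> /(congr1 (fun M : 'rV_ _ => M 0 i)); rewrite !mxE => wA.
by rewrite -[RHS]wA; apply: eq_bigr => k _; rewrite linearZ !mxE.
Qed.

Definition intC (c : C) := exists m : int, c = m%:~R.

Lemma root_principal h l : (forall i, alpha i h = 1) -> root_functional br l ->
  exists2 m : int, l h = m%:~R & m != 0.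
Proof.
move=> h1 lr; have [_ [_ _ /(_ l lr)[c lc]] _] := tri.
have ch : (\sum_i (c i)%:R *: alpha i) h = (\sum_i c i)%:R.
  rewrite sum_lfunE natr_sum; apply: eq_bigr => i _.
  by rewrite scale_lfunE h1 -[_ *: _]/(_ * _) mulr1.
have c0 : (\sum_i c i)%N != 0%N.
  apply: contra lr.1; rewrite sum_nat_eq0 => /forallP c0; apply/eqP.
  have z : \sum_i (c i)%:R *: alpha i = 0.
    by apply: big1 => i _; have /eqP -> := c0 i; rewrite scale0r.
  by case: lc => ->; rewrite z ?oppr0.
case: lc => ->; [exists (\sum_i c i)%N%:Z|exists (- (\sum_i c i)%N%:Z)] => //.
- by rewrite opp_lfunE ch mulrNz.
- by rewrite oppr_eq0.
Qed.

Lemma weight_principal h l : (forall i, alpha i h = 1) -> weight l -> intC (l h).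
Proof.
move=> h1 /weightP[->|/(root_principal h1)[m mh _]]; last by exists m.
by exists 0; rewrite zero_lfunE.
Qed.

Lemma weight_eigen l h : weight l -> eigenvalue (admx (vsval h)) (l h).
Proof.
case=> x x0 lx; apply/eigenvalueP; exists (v2r x).
  by rewrite -admxE lx linearZ.
by apply: contraNneq x0 => vx0; rewrite -[x]v2rK vx0 linear0.
Qed.

Lemma mulfnE a k h : (a *+ k) h = k%:R * a h.
Proof.
elim: k => [|k IH]; first by rewrite zero_lfunE mul0r.
by rewrite mulrSr add_lfunE IH -natr1 mulrDl mul1r.
Qed.

(** The values of the weights of an infinite string on a principal element would
be infinitely many eigenvalues of one endomorphism. *)
Lemma string_stops a b : root_functional br a -> weight b ->
  exists p : nat, weight (b + a *+ p) /\ ~ weight (b + a *+ p.+1).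
Proof.
move=> ra wb; apply: contrapT => /forallNP h.
have wk k : weight (b + a *+ k).
  elim: k => [|k IH]; first by rewrite mulr0n addr0.
  by apply: contrapT => nk; apply: (h k).
have [h0 h1] := exists_principal.
have [m am m0] := root_principal h1 ra.
pose ev k : C := b h0 + (m * k%:Z)%:~R.
have evE k : (b + a *+ k) h0 = ev k.
  by rewrite add_lfunE mulfnE am /ev intrM mulrC.
have ev_inj : injective ev.
  by rewrite /ev => j k /addrI/intr_inj/(mulfI m0)[].
pose p := char_poly (admx (vsval h0)).
have p0 : p != 0 by rewrite monic_neq0// char_poly_monic.
have := @max_poly_roots _ p (map ev (iota 0 (size p))) p0.
rewrite size_map size_iota ltnn => /(_ _ _)/wrap[]//.
  apply/allP => _ /mapP[k _ ->].
  by rewrite -eigenvalue_root_char -evE; exact: weight_eigen.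
by rewrite map_inj_uniq// iota_uniq.
Qed.

(** * The Killing form *)

Definition killing x y : C := \tr (admx x *m admx y).

Lemma admxP (k : C) x y : admx (k *: x + y) = k *: admx x + admx y.
Proof.
apply/row_matrixP => i; rewrite !rowE mulmxDr -scalemxAr.
rewrite -[delta_mx _ _]r2vK -!admxE -linearP; congr v2r.
by rewrite brDl brZl.
Qed.

Lemma killingPr (k : C) x y z :
  killing z (k *: x + y) = k * killing z x + killing z y.
Proof. by rewrite /killing admxP mulmxDr -scalemxAr mxtraceD mxtraceZ. Qed.

Lemma killing0r z : killing z 0 = 0.
Proof. by have := killingPr (-1) 0 0 z; rewrite scaler0 addr0 mulN1r addNr. Qed.

Lemma killingC x y : killing x y = killing y x.
Proof. exact: mxtrace_mulC. Qed.

Lemma admx_br x y : admx (br x y) = admx y *m admx x - admx x *m admx y.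
Proof.
apply/row_matrixP => i; rewrite !rowE mulmxBr !mulmxA.
rewrite -[delta_mx _ _]r2vK -!admxE -linearB; congr v2r.
by rewrite (jacobi x) addrK.
Qed.

Lemma killing_inv x y z : killing (br x y) z = killing x (br y z).
Proof.
rewrite /killing !admx_br mulmxBl mulmxBr !raddfB /=; congr (_ - _).
  by rewrite -mulmxA mxtrace_mulC mulmxA.
by rewrite mulmxA.
Qed.

(** A principal element has integral eigenvalues, not all zero, so the trace
of its square is positive and the radical of the form is not [g]. *)
Lemma killing_nondegenerate x : x != 0 -> exists y, killing x y != 0.
Proof.
have [_ [u [v uv]] ideals] := simple_g.
move=> x0; apply: contrapT => /forallNP kx.
have {}kx y : killing x y = 0 by apply/eqP; apply: contrapT => /negP/kx.
have [|a z w kz kw y|J JP] := @vspace_of (fun z => forall y, killing z y = 0).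
- by move=> y; rewrite killingC killing0r.
- by rewrite killingC killingPr !(killingC y) kz kw mulr0 addr0.
have [z w|J0|Jg] := ideals J.
- rewrite !JP => kw y; rewrite brC -scaleN1r killingC -[_ *: _]addr0.
  by rewrite killingPr killing0r addr0 killingC killing_inv kw mulr0.
- by move: x0; rewrite -memv0 -J0; case/negP; apply/JP.
have K0 z w : killing z w = 0 by apply: (proj1 (JP z)); rewrite Jg memvf.
have [h h1] := exists_principal.
pose rs := undup [seq r <- sval (closed_field_poly_normal
  (char_poly (admx (vsval h)))) | r \is Num.real].
have rsP l : weight l -> l h \in rs.
  move=> wl; rewrite mem_undup mem_filter.
  have [m lm] := weight_principal h1 wl; rewrite {1}lm realz /=.
  have := weight_eigen h wl; rewrite eigenvalue_root_char.
  set p := char_poly _; case: closed_field_poly_normal => r /= ->.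
  rewrite rootZ ?root_prod_XsubC// (monicP (char_poly_monic _)).
  exact: oner_neq0.
have full : (1%:M <= \sum_(r <- rs) eigenspace (admx (vsval h)) r)%MS.
  apply/row_subP => i; rewrite -[row _ _]r2vK.
  apply: (@weight_ind (fun y => (v2r y <= \sum_(r <- rs)
    eigenspace (admx (vsval h)) r)%MS)) => [|a y z yE zE|l y ly].
  - by rewrite linear0 sub0mx.
  - by rewrite linearP addmx_sub// scalemx_sub.
  - have [->|y0] := eqVneq y 0; first by rewrite linear0 sub0mx.
    have lh : l h \in rs by apply: rsP; exists y.
    rewrite (big_rem _ lh)/=; apply: submx_trans (addsmxSl _ _).
    by apply/eigenspaceP; rewrite -admxE ly linearZ.
have ad0 : admx (vsval h) = 0.
  apply: (mxtrace_sq_eq0 (undup_uniq _) _ full (K0 _ _)) => r.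
  by rewrite mem_undup mem_filter => /andP[].
have noroot l : ~ root_functional br l.
  move=> lr; have [m lm m0] := root_principal h1 lr; case: lr => _ [z z0 lz].
  have := admxE (vsval h) z; rewrite ad0 mulmx0 => /eqP.
  rewrite -(linear0 v2r) (can_eq v2rK) lz lm scaler_eq0 (negPf z0) orbF.
  by rewrite intr_eq0 (negPf m0).
have gt z : z \in t.
  apply: (@weight_ind (fun z => z \in t)) => [|a y w yt wt|l y ly].
  - exact: mem0v.
  - by rewrite rpredD// rpredZ.
  - have [->|y0] := eqVneq y 0; first exact: mem0v.
    have /weightP[l0|/noroot//] : weight l by exists y.
    by apply/root_space_0; rewrite -l0.
have [tP _ _] := tri.
by have /tP/(_ u (gt u)) h0 := gt v; rewrite h0 eqxx in uv.
Qed.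

(** By invariance of the form, [x] is orthogonal to all weight spaces but that of
the opposite weight. *)
Lemma killing_opp l x : rsp l x -> x != 0 -> exists2 y, rsp (- l) y & killing x y != 0.
Proof.
move=> lx x0; apply: contrapT => h.
have [y /negP] := killing_nondegenerate x0; apply; apply/eqP.
apply: (@weight_ind (fun y => killing x y = 0)) => [|a z w kz kw|m z mz].
- exact: killing0r.
- by rewrite killingPr kz kw mulr0 addr0.
- apply/eqP; apply: contrapT => /negP kz; apply: h; exists z => //.
  suff <- : m = - l by [].
  apply/lfunP => h; rewrite opp_lfunE; apply: (mulIf kz).
  have := killing_inv x (vsval h) z; rewrite brC -scaleN1r lx mz scalerA.
  have kZ c u v : killing u (c *: v) = c * killing u v.
    by rewrite -[_ *: v]addr0 killingPr killing0r addr0.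
  by rewrite killingC !kZ killingC mulN1r => <-; rewrite mulNr.
Qed.

(** A central element spans an ideal. *)
Lemma center_trivial h : (forall x, br (vsval h) x = 0) -> h = 0.
Proof.
have [_ [u [v uv]] ideals] := simple_g.
move=> hc; have [x y|L0|Lg] := ideals <[vsval h]>%VS.
- by move=> /vlineP[k ->]; rewrite brC brZl hc scaler0 oppr0 mem0v.
- apply/val_inj/eqP; rewrite /= -memv0 -L0; exact: memv_line.
have lin z : exists k, z = k *: vsval h by apply/vlineP; rewrite Lg memvf.
have [[k uE] [m vE]] := (lin u, lin v).
by move: uv; rewrite uE vE brZl hc scaler0 eqxx.
Qed.

(** * sl2-triples and strings of weights *)

Section Ladder.
Context (a : D) (e f : g) (h : subvs_of t).
Context (af : rsp (- a) f) (efh : br e f = vsval h).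

Definition down k x := iter k (br f) x.

Lemma down_rsp b x k : rsp b x -> rsp (b - a *+ k) (down k x).
Proof.
move=> bx; elim: k => [|k IH]; first by rewrite subr0.
by rewrite mulrSr opprD addrA addrC; exact: root_space_br.
Qed.

(** The relation of sl2-theory, multiplied by 2 to avoid a division, for an
arbitrary value of [a h]: it serves for sl2-triples and, with [a h = 0], for
[heisenberg]. *)
Lemma down_br b x k : rsp b x -> br e x = 0 ->
  2 *: br e (down k.+1 x) =
  (k.+1%:R * (2 * b h - k%:R * a h)) *: down k x.
Proof.
move=> bx ex; elim: k => [|k IH].
  by rewrite /= jacobi ex br0r addr0 efh bx mul0r subr0 mul1r scalerA.
have -> : down k.+2 x = br f (down k.+1 x) by [].
rewrite jacobi scalerDr -[X in _ + X]brZr IH brZr efh (down_rsp k.+1 bx) scalerA.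
rewrite -[br f (down k x)]/(down k.+1 x) -scalerDl; congr (_ *: _).
by rewrite add_lfunE opp_lfunE mulfnE -!natr1; ring.
Qed.

(** The ladder of a highest weight vector stops at a step where the
coefficient of [down_br] vanishes. *)
Lemma ladder b x : root_functional br (- a) -> rsp b x -> x != 0 -> br e x = 0 ->
  exists2 K : nat, 2 * b h = K%:R * a h & forall j, (j <= K)%N -> down j x != 0.
Proof.
move=> ra bx x0 ex.
have stop : exists k, down k x == 0.
  have [|p [_ np]] := @string_stops (- a) b ra; first by exists x.
  exists p.+1; apply: contrapT => /negP dn; apply: np.
  by exists (down p.+1 x) => //; rewrite mulNrn; exact: down_rsp.
case: (ex_minnP stop) => -[|K] /= dK minK; first by rewrite dK in x0.
exists K => [|j jK]; last first.
  by apply: contraTneq jK => dj; rewrite -ltnNge minK// dj.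
have dK' : down K x != 0.
  by apply: contraTneq isT => d0; have := minK K; rewrite d0 eqxx ltnn => /(_ isT).
have := down_br K bx ex; rewrite [down K.+1 x](eqP dK) br0r scaler0.
move=> /esym/eqP; rewrite scaler_eq0 (negPf dK') orbF mulf_eq0 pnatr_eq0/=.
by rewrite subr_eq0 => /eqP.
Qed.

End Ladder.

Lemma weightN a h : a (- h) = - a h :> C.
Proof. by rewrite linearN. Qed.

Lemma bracket_t a e f : rsp a e -> rsp (- a) f -> exists h, br e f = vsval h.
Proof.
move=> ae af; have eft : br e f \in t.
  by apply/root_space_0; rewrite -(subrr a); exact: root_space_br.
by exists (Subvs eft).
Qed.

(** A bracket of opposite root vectors on which the root vanishes would act as
zero on every string of weights, hence be central. *)
Lemma heisenberg a e f h : root_functional br a -> root_functional br (- a) ->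
  rsp a e -> rsp (- a) f -> br e f = vsval h -> a h = 0 -> h = 0.
Proof.
move=> ra rna ae af efh ah; apply: center_trivial.
apply: (@weight_ind (fun x => br (vsval h) x = 0)) => [|k x y hx hy|b x bx].
- exact: br0r.
- by rewrite brDr brZr hx hy scaler0 addr0.
have [->|x0] := eqVneq x 0; first exact: br0r.
have [p [[y y0 py] np]] : exists p : nat,
    weight (b + a *+ p) /\ ~ weight (b + a *+ p.+1).
  by apply: string_stops => //; exists x.
have ey : br e y = 0.
  apply/eqP; apply: contrapT => /negP ey; apply: np; exists (br e y) => //.
  by rewrite mulrS addrCA; exact: root_space_br.
have [K + _] := ladder af efh rna py y0 ey.
rewrite add_lfunE mulfnE ah !mulr0 addr0 => /eqP.
by rewrite mulf_eq0 pnatr_eq0/= => /eqP bh; rewrite bx bh scale0r.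
Qed.

Definition sl2 a e f h :=
  [/\ rsp a e, rsp (- a) f, br e f = vsval h & a h = 2].

Lemma sl2_opp a e f h : sl2 a e f h -> sl2 (- a) f e (- h).
Proof.
case=> ae af efh ah; split=> //; rewrite ?opprK//.
- by rewrite brC efh linearN.
- by rewrite opp_lfunE linearN opprK.
Qed.

Lemma sl2_neq0 a e f h : sl2 a e f h -> e != 0.
Proof.
case=> ae af efh ah; apply: contra_eq_neq ah => e0.
have -> : h = 0 by apply/val_inj; rewrite /= -efh e0 br0l.
by rewrite linear0 eq_sym pnatr_eq0.
Qed.

Lemma sl2_root a e f h : sl2 a e f h -> root_functional br a.
Proof.
move=> s; have e0 := sl2_neq0 s; case: s => ae _ _ ah; split; last by exists e.
by apply: contra_eq_neq ah => ->; rewrite zero_lfunE eq_sym pnatr_eq0.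
Qed.

(** Invariance of the Killing form shows that the bracket of two paired opposite
root vectors is not zero; by [heisenberg] the root does not vanish on it, and it
can be scaled. *)
Lemma sl2_exists a : root_functional br a -> exists e f h, sl2 a e f h.
Proof.
move=> ra; have [a0 [e e0 ae]] := ra.
have [f af kef] := killing_opp ae e0.
have rna : root_functional br (- a).
  split; first by rewrite oppr_eq0.
  by exists f => //; apply: contraNneq kef => ->; rewrite killing0r.
have [h efh] := bracket_t ae af.
have ah : a h != 0.
  apply/eqP => /(heisenberg ra rna ae af efh) h0.
  have [k ak] : exists k, a k != 0.
    apply: contrapT => /forallNP ak; move: a0; apply/negP; rewrite negbK.
    apply/eqP/lfunP => k; rewrite zero_lfunE; apply/eqP; apply: contrapT.
    by move=> /negP/ak.
  have := killing_inv (vsval k) e f; rewrite efh h0 linear0 killing0r ae.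
  have -> : killing (a k *: e) f = a k * killing e f.
    by rewrite killingC -[_ *: e]addr0 killingPr killing0r addr0 killingC.
  by move=> /eqP; rewrite mulf_eq0 (negPf kef) orbF (negPf ak).
exists e, ((2 / a h) *: f), ((2 / a h) *: h); split=> //.
- exact: root_spaceZ.
- by rewrite brZr efh linearZ.
- by rewrite linearZ /= -[_ *: _]/(_ * _) divfK.
Qed.

Lemma root_opp a : root_functional br a -> root_functional br (- a).
Proof. by move=> /sl2_exists[e [f [h /sl2_opp/sl2_root]]]. Qed.

(** A vector at the top of the [a]-string through [b], on which [h] has the
nonnegative integral value [K], starts a ladder of [K] steps down. *)
Lemma sl2_top a e f h b : sl2 a e f h -> weight b ->
  exists (p K : nat) x, [/\ b h = K%:R - (2 * p)%:R, rsp (b + a *+ p) x,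
    x != 0, br e x = 0 & (weight (b + a) -> (0 < p)%N) /\
    forall j, (j <= K)%N -> down f j x != 0].
Proof.
move=> s wb; have ra := sl2_root s; have rna := sl2_root (sl2_opp s).
have [ae af efh ah] := s.
have {wb}[p [[x x0 px] np] p0] : exists2 p,
    weight (b + a *+ p) /\ ~ weight (b + a *+ p.+1) & weight (b + a) -> (0 < p)%N.
  have [wba|nba] := pselect (weight (b + a)); last first.
    by exists 0 => //; rewrite mulr0n addr0 mulr1n.
  have [p wp] := string_stops ra wba; exists p.+1 => //.
  by move: wp; rewrite -!addrA -!mulrS.
have ex : br e x = 0.
  apply/eqP; apply: contrapT => /negP ey; apply: np; exists (br e x) => //.
  by rewrite mulrS addrCA; exact: root_space_br.
have [K Kb dK] := ladder af efh rna px x0 ex.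
exists p, K, x; split=> //; apply: (@mulfI _ 2); first by rewrite pnatr_eq0.
move: Kb; rewrite add_lfunE mulfnE ah mulrDr => /(canRL (addrK _)) ->.
by rewrite natrM; ring.
Qed.

Lemma sl2_int a e f h b : sl2 a e f h -> weight b -> intC (b h).
Proof.
move=> s /(sl2_top s)[p [K [x [-> _ _ _ _]]]].
by exists (K%:Z - (2 * p)%N%:Z); rewrite intrB.
Qed.

(** If [b h] is not negative, the ladder from the top of the string passes through
the reflected weight; otherwise the same holds for the opposite triple. *)
Lemma weight_refl a e f h b : sl2 a e f h -> weight b -> weight (b - b h *: a).
Proof.
have key a' e' f' h' b' (m : nat) : sl2 a' e' f' h' -> weight b' ->
    b' h' = m%:R -> weight (b' - b' h' *: a').
  move=> s wb bm; have [p [K [x [bh px x0 ex [_ dK]]]]] := sl2_top s wb.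
  have [_ af _ _] := s.
  have pK : (p <= K)%N.
    move: bh; rewrite bm => /eqP; rewrite eq_sym subr_eq -natrD eqr_nat; lia.
  exists (down f' (K - p) x); first by apply: dK; rewrite leq_subr.
  suff <- : b' + a' *+ p - a' *+ (K - p) = b' - b' h' *: a'.
    exact: down_rsp.
  apply/lfunP => k; rewrite !add_lfunE !opp_lfunE !scale_lfunE !mulfnE bh.
  by rewrite natrB// natrM -[_ *: _]/(_ * _); ring.
move=> s wb; have [[m|m] bh] := sl2_int s wb; first exact: key s wb bh.
have bh' : b (- h) = m.+1%:R by rewrite weightN bh NegzE mulrNz opprK.
by have := key _ _ _ _ _ _ (sl2_opp s) wb bh'; rewrite weightN scalerN scaleNr !opprK.
Qed.

(** Correcting a root vector by a multiple of [e] makes it commute with [f]; were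
it not zero, it would start a ladder upwards from a positive value of [h]. *)
Lemma root_line a x y : root_functional br a -> rsp a x -> x != 0 -> rsp a y ->
  exists k, y = k *: x.
Proof.
move=> ra; have [e [f [h s]]] := sl2_exists ra.
have [ae af efh ah] := s; have rna := root_opp ra.
suff key z : rsp a z -> exists k, z = k *: e.
  move=> /key[k ->]; rewrite scaler_eq0 negb_or => /andP[k0 _] /key[m ->].
  by exists (m / k); rewrite scalerA divfK.
move=> az; have [h1 zfh] := bracket_t az af.
pose k := a h1 / 2; exists k; apply/eqP; rewrite -subr_eq0; apply: contrapT.
move=> /negP z0; have az' : rsp a (z - k *: e).
  by apply: root_spaceD => //; exact/root_spaceN/root_spaceZ.
have zfh' : br (z - k *: e) f = vsval (h1 - k *: h).
  by rewrite brDl brNl brZl zfh efh linearB linearZ.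
have h0 : h1 - k *: h = 0.
  apply: (heisenberg ra rna az' af zfh').
  by rewrite linearB linearZ /= ah -[_ *: _]/(_ * _) /k divfK ?subrr ?pnatr_eq0.
have [na nea feh nah] := sl2_opp s.
have fz : br f (z - k *: e) = 0 by rewrite brC zfh' h0 -[vsval 0]/(0 : g) oppr0.
have [|K + _] := ladder nea feh _ az' z0 fz; first by rewrite opprK.
rewrite nah weightN ah => /eqP; rewrite -subr_eq0 -opprB oppr_eq0 mulrN opprK.
by rewrite -!natrM -natrD pnatr_eq0 addn_eq0 andbC.
Qed.

(** A vector at the top of the [a]-string through [m a] has weight [q a] with
[q > 1]; its ladder reaches the root space of [a], the line of [e], which is
killed by [e], whereas [down_br] gives a nonzero bracket. *)
Lemma no_multiple_root a (m : nat) : root_functional br a -> (1 < m)%N ->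
  ~ weight (a *+ m).
Proof.
move=> ra m1 wm; have [e [f [h s]]] := sl2_exists ra.
have [ae af efh ah] := s; have rna := root_opp ra.
have [p [[x x0 px] np]] := string_stops ra wm.
have ex : br e x = 0.
  apply/eqP; apply: contrapT => /negP ey; apply: np; exists (br e x) => //.
  by rewrite mulrS addrCA; exact: root_space_br.
move: px; rewrite -mulrnDr; set q := (m + p)%N => px.
have [K qK dK] := ladder af efh rna px x0 ex.
have Kq : K = (2 * q)%N.
  move: qK; rewrite mulfnE ah mulrA -!natrM => /eqP; rewrite eqr_nat; lia.
have [r qr] : exists r, q = r.+2 by exists (m + p - 2)%N; rewrite /q; lia.
have d1 : down f r.+1 x != 0 by apply: dK; lia.
have d0 : down f r x != 0 by apply: dK; lia.
have ad : rsp a (down f r.+1 x).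
  suff -> : a = a *+ q - a *+ r.+1 by exact: down_rsp.
  by rewrite qr [a *+ r.+2]mulrS addrK.
have [k dk] := root_line ra ae (sl2_neq0 s) ad.
have := down_br af efh r px ex; rewrite dk brZr br_self !scaler0.
move=> /esym/eqP; rewrite scaler_eq0 (negPf d0) orbF mulf_eq0 pnatr_eq0 /=.
rewrite mulfnE ah -!natrM subr_eq0 eqr_nat qr; lia.
Qed.

(** The bracket is nonzero because one of the two ends of the [a]-string
through [b] carries a ladder reaching [b] and one step beyond. *)
Lemma bracket_neq0 a b x y : root_functional br a -> root_functional br b ->
  root_functional br (a + b) -> rsp a x -> x != 0 -> rsp b y -> y != 0 ->
  br x y != 0.
Proof.
move=> ra rb rab ax x0 by_ y0; have [e [f [h s]]] := sl2_exists ra.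
have [ae af efh ah] := s; have rna := root_opp ra.
have wb : weight b by case: rb.
have [k xk] := root_line ra ae (sl2_neq0 s) ax.
have k0 : k != 0 by apply: contraNneq x0 => k0; rewrite xk k0 scale0r.
rewrite xk brZl scaler_eq0 negb_or k0 /=.
suff [z [bz z0 ez]] : exists z, [/\ rsp b z, z != 0 & br e z != 0].
  have [l yl] := root_line rb bz z0 by_.
  have l0 : l != 0 by apply: contraNneq y0 => l0; rewrite yl l0 scale0r.
  by rewrite yl brZr scaler_eq0 negb_or l0.
have [[m|m] bh] := sl2_int s wb.
  have [p [K [u [bK pu u0 eu [wp dK]]]]] := sl2_top s wb.
  have p0 : (0 < p)%N by apply: wp; rewrite addrC; case: rab.
  have pK : (2 * p <= K)%N.
    move: bK; rewrite bh => /eqP; rewrite eq_sym subr_eq -natrD eqr_nat; lia.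
  case: p p0 pK bK pu wp => // p _ pK bK pu _.
  exists (down f p.+1 u); split; last 1 first.
  - have nz : 2 *: br e (down f p.+1 u) != 0.
      rewrite (down_br af efh p pu eu) scaler_eq0 negb_or dK ?andbT; last by lia.
      rewrite mulf_neq0 ?pnatr_eq0//= add_lfunE mulfnE ah bK.
      have -> : 2 * (K%:R - (2 * p.+1)%:R + p.+1%:R * 2) - p%:R * 2 =
          2 * (K - p)%:R :> C.
        by rewrite natrB; [rewrite natrM; ring|lia].
      by rewrite -natrM pnatr_eq0; lia.
    by apply: contra nz => /eqP ->; rewrite scaler0.
  - suff -> : b = b + a *+ p.+1 - a *+ p.+1 by exact: down_rsp.
    by rewrite addrK.
  - by apply: dK; lia.
have s' := sl2_opp s; have [na nea feh nah] := s'.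
have [q [K [u [bK qu u0 fu [_ dK]]]]] := sl2_top s' wb.
have qK : (q < K)%N.
  have bh' : b (- h) = m.+1%:R by rewrite weightN bh NegzE mulrNz opprK.
  move: bK; rewrite bh' => /eqP.
  by rewrite eq_sym subr_eq -natrD eqr_nat; lia.
exists (down e q u); split.
- suff -> : b = b + (- a) *+ q - (- a) *+ q by exact: down_rsp.
  by rewrite addrK.
- by apply: dK; lia.
- exact: (dK q.+1).
Qed.

End Cartan.
End LieAlgebra.

(** * The root system of the Lie algebra *)

Section Dictionary.
Context (R : realType) (g : vectType R[i]) (br : {bilinear g -> g -> g}).
Context (t : {vspace g}) (n : nat) (alpha : 'I_n -> dual t).
Context (simple_g : simple_lie br) (tri : triangular_decomposition br alpha).
Context (ip : {dot 'rV[R]_n for @idfun R}) (winv : weyl_invariant br alpha ip).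
Local Notation C := (R[i]).
Local Notation rsp := (root_space br).
Local Notation V := 'rV[R]_n.
Local Notation toV := (toV alpha).
Local Notation Delta := (Delta br alpha).
Implicit Types x y z : V.

Lemma toVD x y : toV (x + y) = toV x + toV y.
Proof.
rewrite /Defs.toV -big_split; apply: eq_bigr => i _.
by rewrite mxE rmorphD scalerDl.
Qed.

Lemma toVZ c x : toV (c *: x) = c%:C%C *: toV x.
Proof.
rewrite /Defs.toV scaler_sumr; apply: eq_bigr => i _.
by rewrite mxE rmorphM scalerA.
Qed.

Lemma toVN x : toV (- x) = - toV x.
Proof. by rewrite -scaleN1r toVZ rmorphN rmorph1 scaleN1r. Qed.

Lemma toVB x y : toV (x - y) = toV x - toV y.
Proof. by rewrite toVD toVN. Qed.

Lemma toV0 : toV 0 = 0.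
Proof. by rewrite -(scale0r 0) toVZ rmorph0 scale0r. Qed.

Lemma toV_simple i : toV (simple_root R i) = alpha i.
Proof.
rewrite /Defs.toV (bigD1 i)//= mxE !eqxx scale1r big1 ?addr0// => j ji.
by rewrite mxE (negPf ji) andbF scale0r.
Qed.

Lemma toV_nat (c : 'I_n -> nat) :
  toV (\row_i (c i)%:R) = \sum_i (c i)%:R *: alpha i.
Proof. by apply: eq_bigr => i _; rewrite mxE rmorph_nat. Qed.

Lemma toV_inj : injective toV.
Proof.
suff inj0 x : toV x = 0 -> x = 0.
  move=> x y xy; apply/eqP; rewrite -subr_eq0; apply/eqP/inj0.
  by rewrite toVB xy subrr.
move=> /(alpha_free tri) h; apply/rowP => i; rewrite mxE.
by have := h i; move=> [].
Qed.

(** Invariance under the reflection s_x, applied to [x] and [y], computes the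
value of [y] on the coroot of [x] in terms of the inner product. *)
Lemma weyl_cartan x y e f h (r : R) : Delta x -> sl2 br (toV x) e f h ->
  toV y h = r%:C%C -> cartan ip y x = r.
Proof.
move=> Dx [xe xf efh xh] yh.
have co : is_coroot br (toV x) h by split=> //; exists e, f.
have x0 : x != 0.
  by case: (Dx) => + _; apply: contra_neq => ->; rewrite toV0.
have := winv Dx co (y := x) (y' := - x) (z := y) (z' := y - r *: x).
rewrite toVN toVB toVZ yh xh => /(_ _ erefl)/wrap[].
  by rewrite scaler_nat mulr2n opprD addNKr.
have xx := ip_gt0 ip x0.
rewrite !ipE /cartan => h1; apply: (mulIf (lt0r_neq0 xx)).
by move: h1; rewrite divfK ?lt0r_neq0// (ipC ip y x); lra.
Qed.

Lemma weight_of_root x : Delta x -> weight br (toV x).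
Proof. by case. Qed.

Lemma Delta_refl x y : Delta x -> Delta y ->
  cartan ip y x \is a Num.int /\ Delta (y - cartan ip y x *: x).
Proof.
move=> Dx Dy; have [e [f [h s]]] := sl2_exists simple_g tri Dx.
have [m yh] := sl2_int simple_g tri s (weight_of_root Dy).
have yhR : toV y h = (m%:~R : R)%:C%C by rewrite yh rmorph_int.
have c := weyl_cartan Dx s yhR.
rewrite c intr_int; split=> //.
have wr := weight_refl simple_g tri s (weight_of_root Dy).
have wE : toV (y - m%:~R *: x) = toV y - toV y h *: toV x.
  by rewrite toVB toVZ yhR.
apply: weight_root; first by rewrite wE.
rewrite wE subr_eq0; apply/eqP => yx.
have xh : toV x h = 2 by case: s.
have : toV y h = 2 * toV y h by rewrite {1}yx scale_lfunE xh mulrC.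
move=> /eqP; rewrite -subr_eq0 -{1}[toV y h]mul1r -mulrBl mulf_eq0.
rewrite -[1 - 2]opprB oppr_eq0 addrK oner_eq0 /= => /eqP y0.
by case: Dy => /eqP n0 _; apply: n0; rewrite yx y0 scale0r.
Qed.

Lemma Delta_root_system : root_system Delta ip.
Proof.
split.
- by move=> i; rewrite /Defs.Delta /= toV_simple; have [_ [_ + _] _] := tri.
- by move=> x [+ _]; apply: contra_neq => ->; rewrite toV0.
- by move=> x /(root_opp simple_g tri); rewrite -toVN.
- move=> x Dx; have [_ [_ _ /(_ _ Dx)[c xc]] _] := tri.
  case: xc => xE; [left|right]; apply/root_le0P => i.
    have -> : x = \row_i (c i)%:R by apply: toV_inj; rewrite toV_nat.
    by rewrite mxE natr_nat.
  have -> : - x = \row_i (c i)%:R by apply: toV_inj; rewrite toV_nat toVN xE opprK.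
  by rewrite mxE natr_nat.
- by move=> x y Dx Dy; exact: (Delta_refl Dx Dy).1.
- by move=> x y Dx Dy; exact: (Delta_refl Dx Dy).2.
- move=> i m; rewrite /Defs.Delta /= toVZ toV_simple rmorph_nat scaler_nat => ri.
  have [_ [_ /(_ i) ra _] _] := tri.
  have [m1|m1|//] := ltngtP m 1%N.
    have m0 : m = 0%N by lia.
    by move: ri; rewrite m0 mulr0n  => -[]; rewrite eqxx.
  by case: (no_multiple_root simple_g tri ra m1 ri.2).
Qed.

(** * Abelian ideals and sets of roots *)

Context (theta : V) (htheta : highest_root br alpha theta).
Local Notation P := (Deltap br alpha).
Local Notation roots := (ideal_roots br alpha).
Local Notation H := (Hset br alpha ip theta).

Let rsD := Delta_root_system.
Let Pt : pos_root Delta theta := htheta.1.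
Let tmax : forall x, pos_root Delta x -> root_le x theta := htheta.2.

Lemma root_vector x : Delta x -> exists2 e, e != 0 & rsp (toV x) e.
Proof. by case. Qed.

(** Induction on the number of components: applying [h] and subtracting the
multiple by the value of the first weight removes the first component and
multiplies each other one by a scalar that is not zero for suitable [h]. *)
Lemma separate_weights (U : {vspace g}) :
  (forall (h x : g), h \in t -> x \in U -> br h x \in U) ->
  forall (s : seq V) (F : V -> g), uniq s -> (forall x, rsp (toV x) (F x)) ->
  \sum_(x <- s) F x \in U -> {in s, forall x, F x \in U}.
Proof.
move=> Ut; elim=> [|k s IH] F //= /andP[ks us] wF; rewrite big_cons => FU.
have sU : {in s, forall x, F x \in U}.
  move=> x xs.
  have [h xh] : exists h, (toV x - toV k) h != 0.
    apply: contrapT => /forallNP xk; suff xk0 : toV x - toV k = 0.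
      by move: xk0 ks => /subr0_eq/toV_inj <-; rewrite xs.
    by apply/lfunP => h; rewrite zero_lfunE; apply/eqP; apply: contrapT => /negP/xk.
  pose F' y := (toV y - toV k) h *: F y.
  suff /(_ x xs)/(memvZ ((toV x - toV k) h)^-1) : {in s, forall x, F' x \in U}.
    by rewrite /F' scalerA mulVf// scale1r.
  apply: IH => // [y|]; first by apply: root_spaceZ.
  have -> : \sum_(y <- s) F' y =
      br (vsval h) (F k + \sum_(y <- s) F y) -
      toV k h *: (F k + \sum_(y <- s) F y).
    rewrite brDr wF scalerDr opprD addrACA subrr add0r linear_sumr scaler_sumr.
    rewrite -sumrB; apply: eq_bigr => y _.
    by rewrite wF -scalerBl /F' add_lfunE opp_lfunE.
  by rewrite rpredB ?memvZ ?FU // Ut// subvsP.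
move=> x; rewrite inE => /predU1P[->|/sU//].
by rewrite -(addrK (\sum_(y <- s) F y) (F k)) rpredB// big_seq rpred_sum.
Qed.

Lemma lin_span_gen (A : set g) (x : g) : A x -> lin_span A x.
Proof. by move=> Ax U; apply. Qed.

Lemma lin_span_ind (A : set g) (Q : g -> Prop) : Q 0 ->
  (forall k (x y : g), Q x -> Q y -> Q (k *: x + y)) ->
  (forall x : g, A x -> Q x) -> forall x : g, lin_span A x -> Q x.
Proof.
move=> Q0 Qlin QA x; have [U UQ] := vspace_of Q0 Qlin.
by move=> /(_ U) xU; apply/UQ; apply: xU => y /QA; rewrite UQ.
Qed.

Lemma lin_span_vspace (A : set g) : exists U : {vspace g},
  forall x : g, x \in U <-> lin_span A x.
Proof.
apply: vspace_of => [U _|k x y hx hy U AU]; first exact: mem0v.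
by rewrite rpredD ?memvZ ?hx ?hy.
Qed.

Definition root_vectors (I : set V) : set g := \bigcup_(x in I) rsp (toV x).

Lemma span_decomposition (I : set V) (s : seq V) (z : g) : I `<=` P ->
  uniq s -> (forall x, P x -> x \in s) -> lin_span (root_vectors I) z ->
  exists F, [/\ forall x, rsp (toV x) (F x), forall x, ~ I x -> F x = 0 &
    z = \sum_(x <- s) F x].
Proof.
move=> IP us sP; move: z.
apply: lin_span_ind => [|k y1 y2 [F1 [w1 z1 ->]] [F2 [w2 z2 ->]]|y [x Ix xy]].
- exists (fun=> 0); split=> // [x|]; first exact: root_space0v.
  by rewrite big1.
- exists (fun x => k *: F1 x + F2 x); split=> [x|x nI|].
  + by apply: root_spaceD => //; exact: root_spaceZ.
  + by rewrite z1// z2// scaler0 addr0.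
  + by rewrite scaler_sumr -big_split.
- exists (fun z => if z == x then y else 0); split=> [z|z nI|].
  + by case: eqP => [->//|_]; exact: root_space0v.
  + by case: eqP nI => // ->.
  + rewrite (bigD1_seq x)//= ?eqxx; last by apply/sP/IP.
    by rewrite big1 ?addr0// => z /negPf ->.
Qed.

Lemma borel_root x e : P x -> rsp (toV x) e -> borel br alpha e.
Proof.
move=> px xe; exists e, 0; split; rewrite ?addr0 ?mem0v//.
by apply: lin_span_gen; exists x.
Qed.

Lemma borel_t h : h \in t -> borel br alpha h.
Proof.
move=> ht; exists 0, h; split; rewrite ?add0r// => U _; exact: mem0v.
Qed.

Lemma ideal_roots_ideal a : abelian_ideal br alpha a -> ideal_set Delta (roots a).
Proof.
case=> au ab aa; split=> [x []//|x y [px ax] py Dxy|x y [px ax] [py ay] Dxy].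
- have pxy : P (x + y) := pos_rootD rsD px py Dxy.
  have [e e0 xe] := root_vector px.1; have [f f0 yf] := root_vector py.1.
  split=> // z xyz.
  have fe : rsp (toV (x + y)) (br f e).
    by rewrite addrC toVD; exact: (root_space_br simple_g).
  have fe0 : br f e != 0.
    apply: (bracket_neq0 simple_g tri py.1 px.1 _ yf f0 xe e0).
    by rewrite -toVD addrC.
  have [k ->] := root_line simple_g tri Dxy fe fe0 xyz.
  by apply: memvZ; apply: ab; [exact: borel_root py yf|exact: ax].
- have [e e0 xe] := root_vector px.1; have [f f0 yf] := root_vector py.1.
  have : br e f != 0.
    by apply: (bracket_neq0 simple_g tri px.1 py.1 _ xe e0 yf f0); rewrite -toVD.
  by rewrite (aa _ _ (ax _ xe) (ay _ yf)) eqxx.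
Qed.

(** A nonzero element of the ideal has a nonzero component in some root space, and
this component generates the root space. *)
Lemma ideal_roots_nonempty a : abelian_ideal br alpha a -> a != 0%VS ->
  exists x, roots a x.
Proof.
case=> au ab aa a0; have va := memv_pick a; have := au _ va.
have [s [us sP]] := roots_enum rsD Pt tmax.
move=> /(span_decomposition (fun _ => id) us (fun x => proj1 (sP x))).
move=> [F [wF F0 vF]].
have Fa : {in s, forall x, F x \in a}.
  apply: separate_weights => //; last by rewrite -vF.
  by move=> h x /borel_t; exact: ab.
apply: contrapT => /forallNP h; move: a0; rewrite -vpick0 vF big_seq big1 ?eqxx//.
move=> x xs; apply/eqP; apply: contrapT => /negP Fx0.
have px : P x by apply: contrapT => /F0 Fx; rewrite Fx eqxx in Fx0.
apply: (h x); split=> // y xy.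
have [k ->] := root_line simple_g tri px.1 (wF x) Fx0 xy.
by rewrite memvZ// Fa.
Qed.

Lemma ideal_of_roots (I : set V) : ideal_set Delta I ->
  exists a, [/\ abelian_ideal br alpha a, roots a = I &
    forall b : {vspace g}, I `<=` roots b -> (a <= b)%VS].
Proof.
move=> [IP Iup Iab]; have [a aP] := lin_span_vspace (root_vectors I).
have brD x y e f : Delta x -> P y -> rsp (toV x) e -> rsp (toV y) f ->
    x + y != 0 -> br e f != 0 -> Delta (x + y).
  move=> Dx py xe yf xy0 ef; split.
    by apply: contra_neq xy0; rewrite -toV0 => /toV_inj.
  by exists (br e f) => //; rewrite toVD; exact: (root_space_br simple_g).
have sum0 x y : P x -> P y -> x + y != 0.
  move=> px py; apply/eqP => /(congr1 (@height R n)); rewrite heightD height0.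
  by have := height_gt0 rsD px; have := height_gt0 rsD py; lra.
exists a; split.
- split=> [x /aP|b x + /aP|x y /aP + /aP].
  + by apply: lin_span_ind => [U _|k y z hy hz U AU|y [z Iz zy]];
      [exact: mem0v|rewrite rpredD ?memvZ ?hy ?hz|apply: lin_span_gen;
       exists z => //; exact: IP].
  + move=> [u [h [uu ht ->]]]; move: x.
    apply: lin_span_ind => [|k x y hx hy|x [z Iz zx]].
    * by rewrite br0r mem0v.
    * by rewrite brDr brZr rpredD ?memvZ ?hx.
    rewrite brDl rpredD//; last first.
      rewrite (zx (Subvs ht)) memvZ//; apply/aP/lin_span_gen.
      by exists z.
    move: u uu; apply: lin_span_ind => [|k u v hu hv|u [y py yu]].
    * by rewrite br0l mem0v.
    * by rewrite brDl brZl rpredD ?memvZ ?hu.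
    have pz := IP _ Iz.
    have [->|ux] := eqVneq (br u x) 0; first exact: mem0v.
    have Dyz := brD y z u x py.1 pz yu zx (sum0 _ _ py pz) ux.
    apply/aP/lin_span_gen; exists (z + y); first by apply: Iup => //; rewrite addrC.
    by rewrite addrC toVD; exact: (root_space_br simple_g).
  + move=> hx hy; move: x hx; apply: lin_span_ind => [|k u v hu hv|u [x Ix xu]].
    * exact: br0l.
    * by rewrite brDl brZl hu hv scaler0 addr0.
    move: y hy; apply: lin_span_ind => [|k v w hv hw|v [y Iy yv]].
    * exact: br0r.
    * by rewrite brDr brZr hv hw scaler0 addr0.
    apply/eqP; apply: contrapT => /negP uv; apply: (Iab _ _ Ix Iy).
    have [px py] := (IP _ Ix, IP _ Iy).
    exact: brD px.1 py xu yv (sum0 _ _ px py) uv.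
- apply/seteqP; split=> [x [px xa]|x Ix]; last first.
    split; first exact: IP.
    by move=> y xy; apply/aP/lin_span_gen; exists x.
  have [e e0 xe] := root_vector px.1; apply: contrapT => nI.
  have [s [us sP]] := roots_enum rsD Pt tmax.
  have /aP/(span_decomposition IP us (fun x => proj1 (sP x)))[F [wF F0 eF]] :=
    xa _ xe.
  pose F' y := if y == x then - e else F y.
  have xs : x \in s by apply/sP.
  have /(_ x xs) : {in s, forall y, F' y \in 0%VS}.
    apply: separate_weights => //.
    - by move=> h y _; rewrite memv0 => /eqP ->; rewrite br0r mem0v.
    - by move=> y; rewrite /F'; case: eqP => [->|_]; [exact: root_spaceN|exact: wF].
    rewrite memv0 (bigD1_seq x)//= {1}/F' eqxx eF (bigD1_seq x)//= (F0 x)// add0r.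
    rewrite addrC subr_eq0; apply/eqP; apply: eq_bigr => y /negPf yx.
    by rewrite /F' yx.
  by rewrite /F' eqxx memv0 oppr_eq0 (negPf e0).
- move=> b Ib; apply/subvP => x /aP; apply.
  by move=> y [z /Ib[_ +]]; apply.
Qed.

(** * Rootlets of abelian ideals *)

Local Notation delta := (hat_delta R n).

Lemma hat_posP u : hatDeltap br alpha u <-> aroot Delta u /\ 0 < aheight theta u.
Proof.
split=> [[[x px ->]|[x [k [Dx k1 uE]]]]|[ru hu]].
- split; first exact: aroot_hat px.1.
  by rewrite aheight_hat; exact: (height_gt0 rsD px).
- have {}uE : u = (x, k%:R, 0).
    by rewrite uE; apply: hat_eq; rewrite !levelE /= ?scaler0 ?addr0 ?mulr1 ?add0r ?mulr0.
  have ru : aroot Delta u by rewrite uE; split=> //=; exact: natr_int.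
  split=> //; apply: (aheight_gt0 rsD Pt tmax (i := None)) => //.
  by rewrite uE /acoord /= ltr0n.
- have k0 := acoord_ge0 rsD Pt tmax None ru hu; rewrite /acoord in k0.
  have [Du /intrP[k uk] u0] := ru.
  have uE : u = hat u.1.1 + (u.1.2 : R) *: delta.
    by apply: hat_eq; rewrite !levelE/= ?scaler0 ?addr0 ?mulr1 ?add0r ?mulr0.
  move: k0; rewrite uk ler0z; case: k uk => // -[|k] uk _; [left|right].
    exists u.1.1; last by rewrite {1}uE uk scale0r addr0.
    apply: (pos_height rsD) => //; rewrite -(aheight_hat theta).
    by move: hu; rewrite {1}uE uk scale0r addr0.
  by exists u.1.1, k.+1; split=> //; rewrite {1}uE uk.
Qed.

Lemma minuscule_forP (I : set V) w : I `<=` P ->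
  minuscule_for br alpha ip theta w I <->
  exists2 s, w = wact ip theta s & minuscule_word Delta ip theta s I.
Proof.
move=> IP; split=> [[[s ->] ID inv]|[s -> ms]].
  exists s => // u ru hu; rewrite -/(wact ip theta s) in inv.
  have rw := aroot_wact rsD Pt s ru.
  have invE : aheight theta (wact ip theta s u) < 0 <->
      inversions br alpha (wact ip theta s) u.
    split=> [h|[_ /hat_posP[_]]]; last by rewrite aheightN oppr_gt0.
    split; first exact/hat_posP.
    by apply/hat_posP; rewrite aheightN oppr_gt0; split=> //; exact: (aroot_opp rsD rw).
  by rewrite invE inv; split=> [[x Ix <-]|[x Ix ->]]; exists x.
split; first by exists s.
  by move=> x /IP[].
apply/seteqP; split=> [u [/hat_posP[ru hu] /hat_posP[_]]|_ [x Ix <-]].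
  by rewrite aheightN oppr_gt0 => /(ms _ ru hu)[x Ix ->]; exists x.
have Dx := (IP _ Ix).1.
have rx := aroot_delta_sub rsD Dx; have hx := aheight_delta_sub rsD Pt tmax Dx.
split; first by apply/hat_posP.
apply/hat_posP; rewrite aheightN oppr_gt0; split.
  exact/(aroot_opp rsD)/(aroot_wact rsD Pt).
by apply/(minuscule_in rsD Pt tmax ms Dx).
Qed.

(** The rootlet is computed by the minuscule element of the part of the ideal in
[H], a product of a finite element and [s_0]. *)
Lemma rootletE a : abelian_ideal br alpha a -> a != 0%VS ->
  exists q nu, [/\ minuscule_word Delta ip theta (fin_word0 q) (roots a `&` H), P nu,
    rootlet br alpha ip theta a = hat nu &
    wact ip theta (fin_word0 q) (rootlet_arg theta) = hat nu].
Proof.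
move=> aa a0; have idI := ideal_roots_ideal aa.
have [x Ix] := ideal_roots_nonempty aa a0.
have It := ideal_theta rsD Pt tmax idI Ix.
have [s [q [nu [ms mq pn ts tq]]]] := ideal_minuscule rsD Pt tmax idI It.
exists q, nu; split=> //.
have IP : roots a `<=` P by case: idI.
have ex : exists w, minuscule_for br alpha ip theta w (roots a).
  by exists (wact ip theta s); apply/minuscule_forP => //; exists s.
have : minuscule_for br alpha ip theta
    (minuscule_elt br alpha ip theta (roots a)) (roots a).
  exact: xgetPex ex.
move=> /(minuscule_forP _ IP)[s' wE ms'].
rewrite /rootlet wE (minuscule_inj rsD Pt tmax ms' ms); exact: ts.
Qed.

(** Minuscule elements with the same root set are equal, so the rootlet is a
function of the intersection of the ideal with [H]. *)
Lemma rootlet_cap a q nu :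
  abelian_ideal br alpha a -> a != 0%VS ->
  minuscule_word Delta ip theta (fin_word0 q) (roots a `&` H) ->
  wact ip theta (fin_word0 q) (rootlet_arg theta) = hat nu ->
  rootlet br alpha ip theta a = hat nu.
Proof.
move=> aa a0 mq tq; have [p [k [mp pk -> tp]]] := rootletE aa a0.
by rewrite -tq -tp (minuscule_inj rsD Pt tmax mp mq).
Qed.

Lemma roots_nonzero a x : roots a x -> a != 0%VS.
Proof.
move=> [px xa]; have [e e0 xe] := root_vector px.1.
by apply: contraNneq e0 => a0; have := xa _ xe; rewrite a0 memv0.
Qed.

Lemma Ab_nonempty mu : P mu -> long Delta ip mu -> exists a, Ab br alpha ip theta mu a.
Proof.
move=> pm lm; have lt := theta_long rsD Pt tmax pm lm.
have [q [J [JH Jt mq tq]]] := rootlet_surj rsD Pt tmax lt pm lm.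
have idJ := minuscule_ideal rsD Pt tmax (fun x Jx => (JH _ Jx).1) mq.
have [a [aa aJ _]] := ideal_of_roots idJ.
have a0 : a != 0%VS by apply: (@roots_nonzero a theta); rewrite aJ.
exists a; split=> //; apply: (rootlet_cap (q := q)) => //.
by rewrite aJ setIidl.
Qed.

Lemma Ab_min_minimal mu : (exists a, Ab br alpha ip theta mu a) ->
  let m := Ab_min br alpha ip theta mu in
  Ab br alpha ip theta mu m /\
  forall b, Ab br alpha ip theta mu b -> (b <= m)%VS -> b = m.
Proof.
move=> [a Aa]; apply: (@xgetPex _ 0%VS [set m | Ab br alpha ip theta mu m /\
  forall b, Ab br alpha ip theta mu b -> (b <= m)%VS -> b = m]).
move: {2}(\dim a).+1 (ltnSn (\dim a)) => k; elim: k a Aa => // k IH a Aa ak.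
have [[b [Ab_ ba nba]]|h] := pselect (exists b,
  [/\ Ab br alpha ip theta mu b, (b <= a)%VS & b <> a]).
  apply: (IH b Ab_); rewrite ltnS in ak; apply: leq_trans ak.
  rewrite ltn_neqAle dimvS// andbT; apply/eqP => dba; apply: nba.
  by apply/eqP; rewrite eqEdim ba dba leqnn.
exists a; split=> // b Ab_ ba; apply: contrapT => nba; apply: h.
by exists b.
Qed.

Lemma Ab_iff_cap_H mu a : Deltap_long br alpha ip mu -> abelian_ideal br alpha a ->
  (Ab br alpha ip theta mu a <->
   roots a `&` H = roots (Ab_min br alpha ip theta mu)).
Proof.
move=> [pm lm] aa; have lt : long Delta ip theta := theta_long rsD Pt tmax pm lm.
have [[ma m0 mr] mmin] := Ab_min_minimal (Ab_nonempty pm lm).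
set m := Ab_min _ _ _ _ _ in ma m0 mr mmin *.
have idm := ideal_roots_ideal ma.
have [q [nu [mq pn mn tq]]] := rootletE ma m0.
have nm : nu = mu by move: mn; rewrite mr => /hat_inj.
rewrite {nu mn}nm in pn tq.
(* The part of m in H is an ideal with the same rootlet, so minimality applies. *)
have mH : roots m `&` H = roots m.
  have [b [bb bI bmin]] := ideal_of_roots (ideal_cap_Hroots rsD Pt tmax idm).
  rewrite -bI; congr roots; apply: mmin; last first.
    by apply: bmin => x [].
  have [x mx] := ideal_roots_nonempty ma m0.
  have mt := ideal_theta rsD Pt tmax idm mx.
  have b0 : b != 0%VS.
    apply: (@roots_nonzero b theta); rewrite bI; split=> //.
    exact: (Hroots_theta rsD Pt).
  split=> //; apply: (rootlet_cap (q := q)) => //.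
  by rewrite bI -setIA setIid.
split=> [[_ a0 ar]|aH].
  have [p [k [mp pk ak tp]]] := rootletE aa a0.
  have km : k = mu by move: ak; rewrite ar => /hat_inj.
  rewrite {}km in tp; rewrite -mH.
  have wE : wact ip theta (fin_word0 p) = wact ip theta (fin_word0 q).
    by apply: (rootlet_inj rsD Pt tmax lt pm lm _ _ mp mq tp tq) => x [].
  have sub I J w w' : J `<=` H -> minuscule_word Delta ip theta w I ->
      minuscule_word Delta ip theta w' J ->
      wact ip theta w = wact ip theta w' -> J `<=` I.
    move=> JH mI mJ E x Jx; have Dx := (JH _ Jx).1.1.
    apply/(minuscule_in rsD Pt tmax mI Dx); rewrite E.
    exact/(minuscule_in rsD Pt tmax mJ Dx).
  apply/seteqP; split.
    by apply: (sub _ _ _ _ _ mq mp) => // x [].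
  by apply: (sub _ _ _ _ _ mp mq) => // x [].
have [x mx] := ideal_roots_nonempty ma m0.
have a0 : a != 0%VS.
  by move: mx; rewrite -aH => -[+ _]; exact: roots_nonzero.
split=> //; apply: (rootlet_cap (q := q)) => //.
by rewrite aH -mH.
Qed.

End Dictionary.

Theorem proposition3p2
  (R : realType) (g : vectType R[i]) (br : {bilinear g -> g -> g})
  (t : {vspace g}) (n : nat) (alpha : 'I_n -> dual t)
  (ip : {dot 'rV[R]_n for @idfun R}) (theta mu : 'rV[R]_n)
  (a : {vspace g}) :
  simple_lie br ->
  triangular_decomposition br alpha ->
  weyl_invariant br alpha ip ->
  highest_root br alpha theta ->
  Deltap_long br alpha ip mu ->
  abelian_ideal br alpha a ->
  (Ab br alpha ip theta mu a <->
   ideal_roots br alpha a `&` Hset br alpha ip theta =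
   ideal_roots br alpha (Ab_min br alpha ip theta mu)).
Proof. by move=> simple_g tri winv htheta; exact: Ab_iff_cap_H. Qed.
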